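(* Let $\mathfrak{e}_1=\mathfrak{q}(1)$ be the rank one detecting subalgebra of type $\mathfrak{e}$. Then $T(\mathfrak{e}_1)\cong\mathbb{Z}_2$.
   Context: $k$ is an algebraically closed field of characteristic $0$. $\mathfrak{q}(1)$ is the Lie superalgebra over $k$ with even part spanned by $t$, odd part spanned by $e$, and brackets $[t,t]=0$, $[t,e]=0$, $[e,e]=2t$. All modules are $\mathbb{Z}_2$-graded (supermodules), and homomorphisms are homogeneous of degree $\overline 0$. For a Lie superalgebra $\mathfrak{g}=\mathfrak{g}_{\overline 0}\oplus\mathfrak{g}_{\overline 1}$, $\mathcal{F}=\mathcal{F}_{(\mathfrak{g},\mathfrak{g}_{\overline 0})}$ is the full subcategory of $\mathfrak{g}$-supermodules whose objects are the finite dimensional supermodules that are completely reducible over $\mathfrak{g}_{\overline 0}$. $k_{ev}$ is the trivial supermodule $k$ concentrated in degree $\overline 0$. $M\in\mathcal F$ is endotrivial if $M\otimes M^*\cong k_{ev}\oplus P$ with $P$ projective in $\mathcal F$. The stable module category $\mathrm{Stmod}(\mathcal{F})$ has the same objects as $\mathcal F$, and morphisms are those of $\mathcal{F}$ modulo $f\sim g$ if $f-g$ factors through a projective module in $\mathcal{F}$. $T(\mathfrak{g})$ is the set of isomorphism classes $[M]$ in $\mathrm{Stmod}(\mathcal{F})$ of endotrivial modules, an abelian group under $[M]+[N]=[M\otimes N]$. $\mathbb{Z}_2$ is the group of order two. *)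

(* Defs.v *)
From HB Require Import structures.
From mathcomp Require Import all_boot all_order all_algebra.

Set Implicit Arguments.
Unset Strict Implicit.
Unset Printing Implicit Defensive.

Import GRing.Theory.
Import VectorInternalTheory.

Local Open Scope ring_scope.

(* The two degrees are booleans: false is the degree 0, true is the degree 1, *)
(* addition of degrees is addb, and the Koszul sign is (-1) ^+ (i && j).      *)

Record superspace (k : fieldType) := Superspace {
  scarrier :> vectType k;
  part : bool -> {vspace scarrier};
  part_direct : (part false :&: part true = 0)%VS;
  part_full : (part false + part true = fullv)%VS
}.

Section SuperSpaceTheory.

Variables (k : fieldType) (V : superspace k).

Definition proj (i : bool) : 'End(V) := daddv_pi (part V i) (part V (~~ i)).

(* sgr i is v |-> (-1)^(i |v|) v on homogeneous vectors. *)
Definition sgr (i : bool) : 'End(V) :=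
  proj false + (-1) ^+ i *: proj true.

Definition graded_vs (W : {vspace V}) : Prop :=
  W = (W :&: part V false + W :&: part V true)%VS.

Lemma part_cap i : (part V i :&: part V (~~ i) = 0)%VS.
Proof. by case: i; rewrite /= ?part_direct // capvC part_direct. Qed.

Lemma mem_proj i v : proj i v \in part V i.
Proof. exact: memv_pi. Qed.

Lemma proj_id i v : v \in part V i -> proj i v = v.
Proof. by apply: daddv_pi_id; apply: part_cap. Qed.

Lemma proj_sum v : proj false v + proj true v = v.
Proof.
by apply: daddv_pi_add; rewrite ?part_direct //= part_full memvf.
Qed.

Lemma proj_id0 i v : v \in part V i -> proj (~~ i) v = 0.
Proof.
move=> vi; have := proj_sum v; case: i vi => /= /proj_id ->.
  by rewrite -[RHS]add0r => /addIr.
by rewrite -[RHS]addr0 => /addrI.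
Qed.

Lemma mem_partE i v : (v \in part V i) = (proj i v == v).
Proof.
by apply/idP/eqP => [/proj_id //|<-]; apply: mem_proj.
Qed.

Lemma proj_proj i j v : proj i (proj j v) = if i == j then proj j v else 0.
Proof.
have [->|nij] := eqVneq i j; first by rewrite proj_id ?mem_proj.
have -> : i = ~~ j by case: i j nij => [] [].
by rewrite proj_id0 ?mem_proj.
Qed.

Lemma proj_part i j v : v \in part V j -> proj i v = if i == j then v else 0.
Proof. by move/proj_id <-; apply: proj_proj. Qed.

Lemma sgrE i v : sgr i v = proj false v + (-1) ^+ i *: proj true v.
Proof. by rewrite /sgr add_lfunE scale_lfunE. Qed.

Lemma sgr_part i j v : v \in part V j -> sgr i v = (-1) ^+ (i && j) *: v.
Proof.
move=> vj; rewrite sgrE; case: j vj => vj.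
  by rewrite (proj_id vj) (proj_id0 vj) add0r andbT.
by rewrite (proj_id vj) (proj_id0 vj) scaler0 addr0 andbF scale1r.
Qed.

Lemma sgr_proj i j v : sgr i (proj j v) = (-1) ^+ (i && j) *: proj j v.
Proof. by rewrite (sgr_part _ (mem_proj j v)). Qed.

Lemma sgr_sgr i j v : sgr i (sgr j v) = sgr (i (+) j) v.
Proof.
rewrite (sgrE j) linearD linearZ /= !sgr_proj sgrE andbF scale1r andbT.
by rewrite scalerA -signr_addb addbC.
Qed.

End SuperSpaceTheory.

Lemma split_direct (k : fieldType) (V : vectType k) (W : bool -> {vspace V})
    (p : bool -> 'End(V)) :
    (forall i v, p i v \in W i) -> (forall i v, v \in W i -> p i v = v) ->
    (forall v, p false v + p true v = v) ->
  (W false :&: W true = 0)%VS /\ (W false + W true = fullv)%VS.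
Proof.
move=> pW pid psum; split.
  apply/eqP; rewrite -subv0; apply/subvP => v; rewrite memv_cap => /andP[v0 v1].
  by have := psum v; rewrite !pid // -[RHS]addr0 => /addrI ->; rewrite mem0v.
apply/vspaceP => v; rewrite memvf -(psum v).
by rewrite memv_add.
Qed.

(* These axioms are the usual ones when 2 and 3 are invertible in k. *)
Record lieSuperalgebra (k : fieldType) := LieSuperalgebra {
  lspace :> superspace k;
  br : lspace -> lspace -> lspace;
  br_linear_l : forall y, linear (br^~ y);
  br_linear_r : forall x, linear (br x);
  br_graded : forall i j x y, x \in part lspace i -> y \in part lspace j ->
    br x y \in part lspace (i (+) j);
  br_skew : forall i j x y, x \in part lspace i -> y \in part lspace j ->
    br x y = - (-1) ^+ (i && j) *: br y x;
  br_jacobi : forall i j x y z, x \in part lspace i -> y \in part lspace j ->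
    br x (br y z) = br (br x y) z + (-1) ^+ (i && j) *: br y (br x z)
}.

Record supermodule (k : fieldType) (g : lieSuperalgebra k) := Supermodule {
  mspace :> superspace k;
  act : g -> 'End(mspace);
  act_linear : linear act;
  act_graded : forall i j x v, x \in part g i -> v \in part mspace j ->
    act x v \in part mspace (i (+) j);
  act_br : forall i j x y, x \in part g i -> y \in part g j ->
    act (br x y) = (act x \o act y - (-1) ^+ (i && j) *: (act y \o act x))%VF
}.

Lemma lfun_brE (k : fieldType) (V : vectType k) (f h : 'End(V)) e v :
  (f \o h - e *: (h \o f))%VF v = f (h v) - e *: h (f v).
Proof. by rewrite add_lfunE opp_lfunE scale_lfunE !comp_lfunE. Qed.

Section SupermoduleTheory.

Variables (k : fieldType) (g : lieSuperalgebra k) (M : supermodule g).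

Lemma actD x y : act M (x + y) = act M x + act M y.
Proof. by have := act_linear M 1 x y; rewrite !scale1r. Qed.

Lemma act0 : act M 0 = 0.
Proof. by apply: (addrI (act M 0)); rewrite -actD !addr0. Qed.

Lemma actZ a x : act M (a *: x) = a *: act M x.
Proof. by have := act_linear M a x 0; rewrite act0 !addr0. Qed.

Lemma act_proj i j x v : x \in part g i ->
  act M x (proj M j v) = proj M (i (+) j) (act M x v).
Proof.
move=> xi; rewrite -[in RHS](proj_sum v) linearD linearD /=.
by rewrite !(proj_part _ (act_graded xi (mem_proj _ v))); case: i j {xi} => [] [];
  rewrite /= ?add0r ?addr0.
Qed.

Lemma act_sgr i j x v : x \in part g i ->
  act M x (sgr M j v) = (-1) ^+ (i && j) *: sgr M j (act M x v).
Proof.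
move=> xi; rewrite !sgrE linearD linearZ /= !(act_proj _ _ xi) addbT addbF.
case: i j {xi} => [] [] /=; rewrite ?scale1r ?expr1 ?expr0 //.
  by rewrite scalerDr !scaleN1r opprK addrC.
by rewrite addrC.
Qed.

Lemma act_brE i j x y v : x \in part g i -> y \in part g j ->
  act M (br x y) v =
    act M x (act M y v) - (-1) ^+ (i && j) *: act M y (act M x v).
Proof.
move=> xi yj; rewrite (act_br M xi yj).
exact: lfun_brE.
Qed.

End SupermoduleTheory.

Section LinearMaps.

Variable k : fieldType.
Implicit Types U V W : vectType k.

Definition dual_vs V : vectType k := 'Hom(V, k^o).

(* The transpose f |-> f \o h of h. *)
Definition precomp U V (h : 'Hom(U, V)) : 'Hom(dual_vs V, dual_vs U) :=
  linfun (fun f : dual_vs V => (f \o h)%VF : dual_vs U).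

(* In the coordinates given by v2r, the tensor product is the space of        *)
(* matrices, and u (x) v is the rank one matrix with entries u_i * v_j.       *)
Definition tens_vs U V : vectType k := 'M[k]_(dim U, dim V).

Definition tens U V (u : U) (v : V) : tens_vs U V := (v2r u)^T *m v2r v.

(* f (x) g; see tmap_tens. *)
Definition tmap U V U' V' (f : 'Hom(U, U')) (g : 'Hom(V, V')) :
    'Hom(tens_vs U V, tens_vs U' V') :=
  linfun (fun X : 'M[k]_(dim U, dim V) => (f2mx f)^T *m X *m f2mx g).

Lemma precompE U V (h : 'Hom(U, V)) f : precomp h f = (f \o h)%VF.
Proof.
pose F (f : dual_vs V) : dual_vs U := (f \o h)%VF.
have FL : linear F by move=> a x y; rewrite /F comp_lfunDl comp_lfunZl.
pose FF := HB.pack_for {linear dual_vs V -> dual_vs U} F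
  (GRing.isLinear.Build _ _ _ _ F FL).
exact: (lfunE FF).
Qed.

Lemma tmapE U V U' V' (f : 'Hom(U, U')) (g : 'Hom(V, V')) (X : tens_vs U V) :
  tmap f g X = (f2mx f)^T *m X *m f2mx g.
Proof.
exact: (lfunE (mulmxr (f2mx g) \o mulmx (f2mx f)^T)).
Qed.

Lemma v2r_lfun U V (f : 'Hom(U, V)) u : v2r (f u) = v2r u *m f2mx f.
Proof. by rewrite unlock /= r2vK. Qed.

Lemma tmap_tens U V U' V' (f : 'Hom(U, U')) (g : 'Hom(V, V')) u v :
  tmap f g (tens u v) = tens (f u) (g v).
Proof. by rewrite tmapE /tens !v2r_lfun trmx_mul !mulmxA. Qed.

Lemma tens_linear_l U V (v : V) : linear (fun u : U => tens u v).
Proof. by move=> a x y; rewrite /tens !linearP /= mulmxDl -scalemxAl. Qed.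

Lemma tens_linear_r U V (u : U) : linear (fun v : V => tens u v).
Proof. by move=> a x y; rewrite /tens !linearP. Qed.

Lemma v2r_sum V (v : V) : v = \sum_i v2r v 0 i *: r2v (delta_mx 0 i).
Proof.
rewrite -{1}(v2rK v) {1}(row_sum_delta (v2r v)) linear_sum.
by apply: eq_bigr => i _; rewrite linearZ.
Qed.

Lemma tens_basis U V (X : tens_vs U V) :
  X = \sum_i \sum_j X i j *: tens (r2v (delta_mx 0 i)) (r2v (delta_mx 0 j)).
Proof.
rewrite {1}[X]matrix_sum_delta; apply: eq_bigr => i _; apply: eq_bigr => j _.
by rewrite /tens !r2vK trmx_delta mul_delta_mx.
Qed.

(* The linear extension of a bilinear map to the tensor product. *)
Lemma tens_universal U V W (b : U -> V -> W) :
    (forall v, linear (b^~ v)) -> (forall u, linear (b u)) ->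
  exists! h : 'Hom(tens_vs U V, W), forall u v, h (tens u v) = b u v.
Proof.
move=> bl br.
pose bL v := HB.pack_for {linear U -> W} (b^~ v)
  (GRing.isLinear.Build _ _ _ _ (b^~ v) (bl v)).
pose bR u := HB.pack_for {linear V -> W} (b u)
  (GRing.isLinear.Build _ _ _ _ (b u) (br u)).
pose F (X : tens_vs U V) : W :=
  \sum_i \sum_j X i j *: b (r2v (delta_mx 0 i)) (r2v (delta_mx 0 j)).
have FL : linear F.
  move=> a x y; rewrite /F scaler_sumr -big_split /=; apply: eq_bigr => i _.
  rewrite scaler_sumr -big_split /=; apply: eq_bigr => j _.
  by rewrite !mxE scalerDl scalerA.
pose FF := HB.pack_for {linear tens_vs U V -> W} F
  (GRing.isLinear.Build _ _ _ _ F FL).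
exists (linfun FF); split=> [u v|h hP].
  rewrite lfunE /= /F -[RHS]/(bL v u) {2}(v2r_sum u) linear_sum.
  apply: eq_bigr => i _; rewrite linearZ /= {2}(v2r_sum v).
  rewrite -[b _ _]/(bR _ _) linear_sum scaler_sumr; apply: eq_bigr => j _.
  by rewrite linearZ /= scalerA /tens mxE big_ord1 mxE.
apply/lfunP => X; rewrite lfunE /= [X in RHS]tens_basis linear_sum.
apply: eq_bigr => i _; rewrite linear_sum; apply: eq_bigr => j _.
by rewrite linearZ /= hP.
Qed.

End LinearMaps.

Section Tensor.

Variable k : fieldType.

Lemma tens_ext (U V W : vectType k) (h h' : 'Hom(tens_vs U V, W)) :
  (forall u v, h (tens u v) = h' (tens u v)) -> h = h'.
Proof.
move=> eqh; apply/lfunP => X; rewrite [X]tens_basis !linear_sum.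
apply: eq_bigr => i _; rewrite !linear_sum; apply: eq_bigr => j _.
by rewrite !linearZ /= eqh.
Qed.

Lemma addr_shuffle (V : zmodType) (a b c d p q : V) :
  a + b + (c + d) = a + p + (q + c) + (b - q + (- p + d)).
Proof.
rewrite [RHS](AC ((2*2)*(2*2)) (((1*5)*(4*8))*((2*7)*(3*6)))).
by rewrite /= !subrr !addr0.
Qed.

Section Bilinearity.
Variables U V : vectType k.
Implicit Types (u : U) (v : V).

Lemma tensDl u u' v : tens (u + u') v = tens u v + tens u' v.
Proof. by have := tens_linear_l v 1 u u'; rewrite !scale1r. Qed.

Lemma tensDr u v v' : tens u (v + v') = tens u v + tens u v'.
Proof. by have := tens_linear_r u 1 v v'; rewrite !scale1r. Qed.

Lemma tens0l v : tens 0 v = 0 :> tens_vs U V.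
Proof. by rewrite /tens linear0 trmx0 mul0mx. Qed.

Lemma tens0r u : tens u 0 = 0 :> tens_vs U V.
Proof. by rewrite /tens linear0 mulmx0. Qed.

Lemma tensZl a u v : tens (a *: u) v = a *: tens u v.
Proof. by have := tens_linear_l v a u 0; rewrite tens0l !addr0. Qed.

Lemma tensZr a u v : tens u (a *: v) = a *: tens u v.
Proof. by have := tens_linear_r u a v 0; rewrite tens0r !addr0. Qed.
End Bilinearity.

Section TensorSpace.
Variables U V : superspace k.

(* (U (x) V)_l is the sum of the U_i (x) V_(i + l). *)
Definition tens_part (l : bool) : {vspace tens_vs U V} :=
  (\sum_(i : bool) limg (tmap (proj U i) (proj V (i (+) l))))%VS.

Lemma mem_tens i j u v : u \in part U i -> v \in part V j ->
  tens u v \in tens_part (i (+) j).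
Proof.
move=> ui vj; apply/memv_sumP.
exists (fun l => if l == i then tens u v else 0).
  move=> l _; case: eqP => [->|_]; last exact: mem0v.
  by rewrite addKb -(proj_id ui) -(proj_id vj) -tmap_tens memv_img ?memvf.
by rewrite -big_mkcond big_pred1_eq.
Qed.

Lemma tens_part_ind (V' : vectType k) (W : {vspace V'})
    (h : 'Hom(tens_vs U V, V')) l w :
    (forall i u v, u \in part U i -> v \in part V (i (+) l) ->
      h (tens u v) \in W) ->
  w \in tens_part l -> h w \in W.
Proof.
move=> hW /memv_sumP[f fi ->]; rewrite linear_sum memv_suml // => i _.
have /memv_imgP[X _ ->] := fi i isT.
rewrite [X]tens_basis !linear_sum memv_suml // => m _.
rewrite !linear_sum memv_suml // => n _.
by rewrite !linearZ /= memvZ // tmap_tens (hW i) // mem_proj.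
Qed.

Let tproj (l : bool) : 'End(tens_vs U V) :=
  tmap (proj U false) (proj V l) + tmap (proj U true) (proj V (~~ l)).

Fact tens_split :
  (tens_part false :&: tens_part true = 0)%VS /\
  (tens_part false + tens_part true = fullv)%VS.
Proof.
apply: (@split_direct _ _ _ tproj) => [l w|l w wl|w].
- rewrite [w]tens_basis !linear_sum memv_suml // => m _.
  rewrite !linear_sum memv_suml // => n _.
  rewrite linearZ memvZ //= add_lfunE !tmap_tens memvD //.
    exact: (mem_tens (mem_proj false _) (mem_proj l _)).
  have := mem_tens (mem_proj true (r2v (delta_mx 0 m)))
    (mem_proj (~~ l) (r2v (delta_mx 0 n))).
  by rewrite /= negbK.
- apply/eqP; rewrite -subr_eq0 -memv0.
  have -> : tproj l w - w = (tproj l - \1%VF) w.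
    by rewrite add_lfunE opp_lfunE id_lfunE.
  apply: tens_part_ind wl => i u v ui vi.
  rewrite memv0 !add_lfunE opp_lfunE id_lfunE !tmap_tens.
  rewrite !(proj_part _ ui) !(proj_part _ vi).
  by case: i l {ui vi} => [] []; rewrite /= ?tens0l ?add0r ?addr0 subrr.
have -> : tproj false w + tproj true w = (tproj false + tproj true) w.
  by rewrite add_lfunE.
have -> : tproj false + tproj true = \1%VF; last by rewrite id_lfunE.
apply: tens_ext => u v; rewrite !add_lfunE !tmap_tens id_lfunE /=.
rewrite addrACA [X in _ + X]addrC -!tensDr !proj_sum.
by rewrite -tensDl proj_sum.
Qed.

Definition tens_space : superspace k :=
  Superspace (proj1 tens_split) (proj2 tens_split).

End TensorSpace.

Variable g : lieSuperalgebra k.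

Section TensorModule.
Variables M N : supermodule g.

(* x (u (x) v) = x u (x) v + (-1)^(|x| |u|) u (x) x v; see tens_actE. *)
Definition tens_act (x : g) : 'End(tens_space M N) :=
  tmap (act M x) \1 + \sum_(i : bool) tmap (sgr M i) (act N (proj g i x)).

Lemma tens_act_hom i x u v : x \in part g i ->
  tens_act x (tens u v) = tens (act M x u) v + tens (sgr M i u) (act N x v).
Proof.
move=> xi; rewrite add_lfunE sum_lfunE tmap_tens id_lfunE (bigD1 i) //=.
rewrite tmap_tens (proj_id xi) big1 ?addr0 // => j nji.
by rewrite (proj_part _ xi) (negPf nji) act0 tmap_tens zero_lfunE tens0r.
Qed.

Lemma tens_actE i j x u v : x \in part g i -> u \in part M j ->
  tens_act x (tens u v) =
    tens (act M x u) v + (-1) ^+ (i && j) *: tens u (act N x v).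
Proof.
by move=> xi uj; rewrite (tens_act_hom _ _ xi) (sgr_part _ uj) tensZl.
Qed.

Fact tens_act_linear : linear tens_act.
Proof.
move=> a x y; apply: tens_ext => u v.
rewrite [RHS]add_lfunE scale_lfunE !add_lfunE !sum_lfunE !tmap_tens !id_lfunE.
rewrite act_linear add_lfunE scale_lfunE tensDl tensZl scalerDr addrACA.
congr (_ + _); rewrite scaler_sumr -big_split; apply: eq_bigr => i _ /=.
rewrite !tmap_tens linearP act_linear.
by rewrite -tensZr -tensDr; congr (tens _ _); rewrite add_lfunE scale_lfunE.
Qed.

Fact tens_act_graded i j x w :
    x \in part g i -> w \in part (tens_space M N) j ->
  tens_act x w \in part (tens_space M N) (i (+) j).
Proof.
move=> xi; apply: tens_part_ind => l u v ul vl.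
rewrite (tens_actE _ xi ul) memvD ?memvZ //.
  have := mem_tens (act_graded xi ul) vl.
  by rewrite addbA addbK.
have := mem_tens ul (act_graded xi vl).
by rewrite addbCA addKb.
Qed.

Fact tens_act_br i j x y : x \in part g i -> y \in part g j ->
  tens_act (br x y) = (tens_act x \o tens_act y
    - (-1) ^+ (i && j) *: (tens_act y \o tens_act x))%VF.
Proof.
move=> xi yj; apply: tens_ext => u v.
rewrite lfun_brE.
rewrite (tens_act_hom _ _ (br_graded xi yj)).
rewrite (tens_act_hom _ _ xi) (tens_act_hom _ _ yj) !linearD /=.
rewrite !(tens_act_hom _ _ xi) !(tens_act_hom _ _ yj).
rewrite (act_brE _ xi yj) (act_brE _ xi yj).
rewrite !sgr_sgr (act_sgr _ _ xi) (act_sgr _ _ yj) [j (+) i]addbC [j && i]andbC.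
set e : k := (-1) ^+ (i && j).
have ee : e * e = 1 by rewrite /e -signr_addb addbb.
rewrite -!scaleNr !tensDl !tensDr !tensZl !tensZr !scalerDr !scalerA !mulNr ee.
rewrite !scaleNr scale1r; exact: addr_shuffle.
Qed.

Definition tens_mod : supermodule g :=
  Supermodule tens_act_linear tens_act_graded tens_act_br.

End TensorModule.
End Tensor.

Section Dual.

Variable k : fieldType.

Section DualSpace.
Variable V : superspace k.

(* (V^* )_i consists of the functionals that vanish on V_(1 - i). *)
Definition dual_part (i : bool) : {vspace dual_vs V} :=
  lker (precomp (proj V (~~ i))).

Lemma dual_partP i (f : dual_vs V) :
  reflect (forall v, v \in part V (~~ i) -> f v = 0) (f \in dual_part i).
Proof.
rewrite memv_ker precompE; apply: (iffP eqP) => [f0 v vi | f0].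
  by rewrite -(proj_id vi) -comp_lfunE f0 zero_lfunE.
by apply/lfunP => v; rewrite comp_lfunE zero_lfunE f0 ?mem_proj.
Qed.

Fact dual_split :
  (dual_part false :&: dual_part true = 0)%VS /\
  (dual_part false + dual_part true = fullv)%VS.
Proof.
apply: (@split_direct _ _ _ (fun i => precomp (proj V i))) => [i f|i f /dual_partP fi|f].
- rewrite precompE; apply/dual_partP => v vi.
  by rewrite comp_lfunE (proj_part _ vi); case: i {vi}; rewrite linear0.
- apply/lfunP => v; rewrite precompE comp_lfunE -[in RHS](proj_sum v) linearD /=.
  have fj : f (proj V (~~ i) v) = 0 by rewrite fi ?mem_proj.
  by case: i fj {fi} => /= ->; rewrite ?add0r ?addr0.
by apply/lfunP => v; rewrite add_lfunE !precompE !comp_lfunE -linearD /= proj_sum.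
Qed.

Definition dual_space : superspace k :=
  Superspace (proj1 dual_split) (proj2 dual_split).

End DualSpace.

Variables (g : lieSuperalgebra k) (M : supermodule g).

(* (x f)(v) = - (-1)^(|x| |f|) f (x v); see dual_actE. *)
Definition dual_act (x : g) : 'End(dual_space M) :=
  - \sum_(i : bool) precomp (sgr M i \o act M (proj g i x))%VF.

Lemma dual_act_hom i x (f : dual_space M) v : x \in part g i ->
  dual_act x f v = - f (sgr M i (act M x v)).
Proof.
move=> xi; have -> : dual_act x = - precomp (sgr M i \o act M x)%VF.
  rewrite /dual_act (bigD1 i) //= (proj_id xi) big1 ?addr0 // => j nji.
  apply/lfunP => h; apply/lfunP => w; rewrite precompE !comp_lfunE.
  by rewrite (proj_part _ xi) (negPf nji) act0 !zero_lfunE !linear0.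
by rewrite !opp_lfunE precompE !comp_lfunE.
Qed.

Lemma dual_sgr i j (f : dual_space M) v : f \in part (dual_space M) j ->
  f (sgr M i v) = (-1) ^+ (i && j) * f v.
Proof.
move=> /dual_partP fj; rewrite sgrE -[in RHS](proj_sum v) !linearD linearZ /=.
have /= := fj (proj M (~~ j) v) (mem_proj _ _).
case: j fj => _ /= ->; first by rewrite !add0r andbT.
by rewrite scaler0 !addr0 andbF mul1r.
Qed.

Lemma dual_actE i j x (f : dual_space M) v :
    x \in part g i -> f \in part (dual_space M) j ->
  dual_act x f v = - ((-1) ^+ (i && j) * f (act M x v)).
Proof. by move=> xi fj; rewrite (dual_act_hom _ _ xi) (dual_sgr _ _ fj). Qed.

Fact dual_act_linear : linear dual_act.
Proof.
move=> a x y; apply/lfunP => f; apply/lfunP => v.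
rewrite [in RHS]add_lfunE scale_lfunE !opp_lfunE !sum_lfunE.
rewrite add_lfunE scale_lfunE !opp_lfunE !sum_lfunE scalerN -opprD; congr (- _).
rewrite scaler_sumr -big_split; apply: eq_bigr => i _ /=.
rewrite !precompE !comp_lfunE linearP act_linear.
by rewrite [X in f (sgr M i X)]add_lfunE scale_lfunE !linearP.
Qed.

Fact dual_act_graded i j x f :
    x \in part g i -> f \in part (dual_space M) j ->
  dual_act x f \in part (dual_space M) (i (+) j).
Proof.
move=> xi fj; apply/dual_partP => v vij; rewrite (dual_actE _ xi fj).
have /dual_partP -> := fj; first by rewrite mulr0 oppr0.
by have := act_graded xi vij; rewrite -addbN addKb.
Qed.

Fact dual_act_br i j x y : x \in part g i -> y \in part g j ->
  dual_act (br x y) = (dual_act x \o dual_act y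
    - (-1) ^+ (i && j) *: (dual_act y \o dual_act x))%VF.
Proof.
move=> xi yj; apply/lfunP => f; apply/lfunP => v.
have subE e (h h' : dual_space M) : (h - e *: h') v = h v - e * h' v.
  by rewrite add_lfunE opp_lfunE scale_lfunE.
rewrite lfun_brE subE (dual_act_hom _ _ (br_graded xi yj)).
rewrite !(dual_act_hom _ _ xi) !(dual_act_hom _ _ yj).
rewrite !(dual_act_hom _ _ xi) !opprK.
rewrite (act_sgr _ _ xi) (act_sgr _ _ yj) !linearZ /= !sgr_sgr.
rewrite (act_brE _ xi yj) linearB linearZ /= linearB linearZ /=.
rewrite [j (+) i]addbC [j && i]andbC.
set e : k := (-1) ^+ (i && j).
have ee : e * e = 1 by rewrite /e -signr_addb addbb.
by rewrite mulrA ee mul1r opprB.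
Qed.

Definition dual_mod : supermodule g :=
  Supermodule dual_act_linear dual_act_graded dual_act_br.

End Dual.

Section DirectSum.

Variable k : fieldType.

Definition prod_vs (U V : vectType k) : vectType k := (U * V)%type.

Definition prod_map (U V U' V' : vectType k) (f : 'Hom(U, U')) (h : 'Hom(V, V')) :
    'Hom(prod_vs U V, prod_vs U' V') :=
  linfun (fun w : prod_vs U V => (f w.1, h w.2) : prod_vs U' V').

Lemma prod_mapE (U V U' V' : vectType k) (f : 'Hom(U, U')) (h : 'Hom(V, V')) w :
  prod_map f h w = (f w.1, h w.2).
Proof.
pose F (w : prod_vs U V) : prod_vs U' V' := (f w.1, h w.2).
have FL : linear F by move=> a x y; rewrite /F /= !linearP.
pose FF := HB.pack_for {linear prod_vs U V -> prod_vs U' V'} F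
  (GRing.isLinear.Build _ _ _ _ F FL).
exact: (lfunE FF).
Qed.

Section SumSpace.
Variables U V : superspace k.

Definition sum_part (i : bool) : {vspace prod_vs U V} :=
  limg (prod_map (proj U i) (proj V i)).

Lemma sum_partE i w :
  (w \in sum_part i) = (w.1 \in part U i) && (w.2 \in part V i).
Proof.
apply/memv_imgP/andP => [[z _ ->]|[w1 w2]]; first by rewrite prod_mapE !mem_proj.
by exists w; rewrite ?memvf // prod_mapE !proj_id //; case: w {w1 w2}.
Qed.

Fact sum_split :
  (sum_part false :&: sum_part true = 0)%VS /\
  (sum_part false + sum_part true = fullv)%VS.
Proof.
apply: (@split_direct _ _ _ (fun i => prod_map (proj U i) (proj V i))) => [i w|i w|w].
- by rewrite memv_img ?memvf.
- by rewrite sum_partE prod_mapE => /andP[/proj_id-> /proj_id->]; case: w.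
by rewrite !prod_mapE; case: w => u v; congr (_, _); apply: proj_sum.
Qed.

Definition sum_space : superspace k :=
  Superspace (proj1 sum_split) (proj2 sum_split).

End SumSpace.

Variables (g : lieSuperalgebra k) (M N : supermodule g).

Definition sum_act (x : g) : 'End(sum_space M N) := prod_map (act M x) (act N x).

Fact sum_act_linear : linear sum_act.
Proof.
move=> a x y; apply/lfunP => w.
rewrite add_lfunE scale_lfunE !prod_mapE !act_linear.
by rewrite !add_lfunE !scale_lfunE.
Qed.

Fact sum_act_graded i j x w :
    x \in part g i -> w \in part (sum_space M N) j ->
  sum_act x w \in part (sum_space M N) (i (+) j).
Proof.
move=> xi; rewrite /= !sum_partE prod_mapE /= => /andP[w1 w2].
by rewrite !act_graded.
Qed.

Fact sum_act_br i j x y : x \in part g i -> y \in part g j ->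
  sum_act (br x y) = (sum_act x \o sum_act y
    - (-1) ^+ (i && j) *: (sum_act y \o sum_act x))%VF.
Proof.
move=> xi yj; apply/lfunP => w.
rewrite lfun_brE !prod_mapE /=.
by rewrite !(act_brE _ xi yj).
Qed.

Definition sum_mod : supermodule g :=
  Supermodule sum_act_linear sum_act_graded sum_act_br.

End DirectSum.

Section Trivial.

Variable k : fieldType.

Definition line_part (i : bool) : {vspace k^o} := if i then 0%VS else fullv.

Fact line_direct : (line_part false :&: line_part true = 0)%VS.
Proof. exact: capv0. Qed.

Fact line_full : (line_part false + line_part true = fullv)%VS.
Proof. exact: addv0. Qed.

Definition line_space : superspace k := Superspace line_direct line_full.

Variable g : lieSuperalgebra k.

Definition triv_act (x : g) : 'End(line_space) := 0.

Fact triv_act_linear : linear triv_act.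
Proof. by move=> a x y; rewrite /triv_act scaler0 addr0. Qed.

Fact triv_act_graded i j x v : x \in part g i -> v \in part line_space j ->
  triv_act x v \in part line_space (i (+) j).
Proof. by rewrite zero_lfunE mem0v. Qed.

Fact triv_act_br i j x y : x \in part g i -> y \in part g j ->
  triv_act (br x y) = (triv_act x \o triv_act y
    - (-1) ^+ (i && j) *: (triv_act y \o triv_act x))%VF.
Proof. by rewrite /triv_act comp_lfun0l scaler0 subr0. Qed.

Definition triv_mod : supermodule g :=
  Supermodule triv_act_linear triv_act_graded triv_act_br.

End Trivial.

Section Category.

Variables (k : fieldType) (g : lieSuperalgebra k).
Implicit Types M N P Q : supermodule g.

Definition is_hom M N (f : 'Hom(M, N)) : Prop :=
  (forall i v, v \in part M i -> f v \in part N i) /\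
  (forall x v, f (act M x v) = act N x (f v)).

Definition iso M N : Prop :=
  exists (f : 'Hom(M, N)) (h : 'Hom(N, M)),
    [/\ is_hom f, is_hom h, cancel f h & cancel h f].

Definition even_sub M (W : {vspace M}) : Prop :=
  graded_vs W /\
  (forall x w, x \in part g false -> w \in W -> act M x w \in W).

Definition even_simple M (S : {vspace M}) : Prop :=
  [/\ even_sub S, S <> 0%VS &
      forall W : {vspace M}, even_sub W -> (W <= S)%VS -> W = 0%VS \/ W = S].

(* M is a direct sum of simple supermodules over the even part of g; it is    *)
(* finite dimensional because its carrier is a vectType.                      *)
Definition inF M : Prop :=
  exists (n : nat) (S : 'I_n -> {vspace M}),
    [/\ forall i, even_simple (S i), directv (\sum_i S i)
      & (\sum_i S i = fullv)%VS].

(* An epimorphism of F is a surjection, since F is closed under quotients. *)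
Definition projectiveF P : Prop :=
  inF P /\
  forall M N (h : 'Hom(M, N)) (f : 'Hom(P, N)), inF M -> inF N ->
    is_hom h -> limg h = fullv -> is_hom f ->
    exists f' : 'Hom(P, M), is_hom f' /\ (h \o f')%VF = f.

Definition stably_equal M N (f f' : 'Hom(M, N)) : Prop :=
  exists P (a : 'Hom(M, P)) (b : 'Hom(P, N)),
    [/\ projectiveF P, is_hom a, is_hom b & f - f' = (b \o a)%VF].

Definition stable_iso M N : Prop :=
  exists (f : 'Hom(M, N)) (h : 'Hom(N, M)),
    [/\ is_hom f, is_hom h, stably_equal (h \o f)%VF \1%VF
      & stably_equal (f \o h)%VF \1%VF].

Definition endotrivial M : Prop :=
  inF M /\
  exists P, projectiveF P /\
    iso (tens_mod M (dual_mod M)) (sum_mod (triv_mod g) P).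

Definition stable_class M : supermodule g -> Prop :=
  fun N => inF N /\ stable_iso M N.

(* The set T(g): a class in the stable category is represented by the         *)
(* predicate of belonging to it.                                              *)
Definition TG : Type :=
  {C : supermodule g -> Prop | exists2 M, endotrivial M & C = stable_class M}.

Definition cls M (Me : endotrivial M) : TG :=
  exist _ (stable_class M) (ex_intro2 _ _ M Me (erefl _)).

(* add is the operation [M] + [N] = [M (x) N] on T(g); in particular T(g) is  *)
(* closed under it and [M (x) N] only depends on the classes [M] and [N].     *)
Definition tensor_law (add : TG -> TG -> TG) : Prop :=
  forall M N (Me : endotrivial M) (Ne : endotrivial N),
    exists MNe : endotrivial (tens_mod M N), add (cls Me) (cls Ne) = cls MNe.

End Category.

Arguments TG {k} g.
Arguments tensor_law {k g} add.

Section Q1.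

Variable k : fieldType.

(* (a, b) stands for a t + b e. *)
Definition q1_vs : vectType k := (k^o * k^o)%type.

Definition q1_t : q1_vs := (1, 0).
Definition q1_e : q1_vs := (0, 1).

Definition q1_part (i : bool) : {vspace q1_vs} :=
  if i then <[q1_e]>%VS else <[q1_t]>%VS.

Lemma q1_partE i (x : q1_vs) :
  (x \in q1_part i) = (if i then x.1 == 0 else x.2 == 0).
Proof.
case: i x => [] [a b] /=.
  apply/vlineP/eqP => [[c [-> _]]|->]; first exact: mulr0.
  by exists b; congr (_, _); rewrite /GRing.scale /= ?mulr0 ?mulr1.
apply/vlineP/eqP => [[c [_ ->]]|->]; first exact: mulr0.
by exists a; congr (_, _); rewrite /GRing.scale /= ?mulr0 ?mulr1.
Qed.

Fact q1_direct : (q1_part false :&: q1_part true = 0)%VS.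
Proof.
apply/eqP; rewrite -subv0; apply/subvP => [[a b]].
by rewrite memv_cap !q1_partE memv0 /= => /andP[/eqP-> /eqP->].
Qed.

Fact q1_full : (q1_part false + q1_part true = fullv)%VS.
Proof.
apply/vspaceP => [[a b]]; rewrite memvf; apply/memv_addP.
exists (a, 0); first by rewrite q1_partE.
exists (0, b); first by rewrite q1_partE.
by congr (_, _); rewrite ?addr0 ?add0r.
Qed.

Definition q1_space : superspace k := Superspace q1_direct q1_full.

Definition q1_br (x y : q1_space) : q1_space := (x.2 * y.2 *+ 2, 0).

Lemma q1_br_tt : q1_br q1_t q1_t = 0.
Proof. by rewrite /q1_br mulr0 mul0rn. Qed.

Lemma q1_br_te : q1_br q1_t q1_e = 0.
Proof. by rewrite /q1_br mul0r mul0rn. Qed.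

Lemma q1_br_ee : q1_br q1_e q1_e = q1_t *+ 2.
Proof. by rewrite /q1_br mulr1 !mulr2n; congr (_, _); rewrite addr0. Qed.

Fact q1_br_linear_l y : linear (q1_br^~ y).
Proof.
move=> a x z; congr (_, _); last by rewrite /= scaler0 addr0.
by rewrite /= mulrDl mulrnDl -scalerAl scalerMnr.
Qed.

Fact q1_br_linear_r x : linear (q1_br x).
Proof.
move=> a y z; congr (_, _); last by rewrite /= scaler0 addr0.
by rewrite /= mulrDr mulrnDl -scalerAr scalerMnr.
Qed.

Fact q1_br_graded i j x y :
    x \in part q1_space i -> y \in part q1_space j ->
  q1_br x y \in part q1_space (i (+) j).
Proof.
rewrite /= !q1_partE; case: i j => [] [] //= /eqP x0 /eqP y0.
  by rewrite y0 mulr0 mul0rn.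
by rewrite x0 mul0r mul0rn.
Qed.

Fact q1_br_skew i j x y :
    x \in part q1_space i -> y \in part q1_space j ->
  q1_br x y = - (-1) ^+ (i && j) *: q1_br y x.
Proof.
rewrite /= !q1_partE /q1_br mulrC => xi yj.
case: i j xi yj => [] [] /= /eqP x0 /eqP y0; first by rewrite opprK scale1r.
- by rewrite y0 mul0r mul0rn; congr (_, _); rewrite scaler0.
- by rewrite x0 mulr0 mul0rn; congr (_, _); rewrite scaler0.
by rewrite x0 mulr0 mul0rn; congr (_, _); rewrite scaler0.
Qed.

Fact q1_br_jacobi i j x y z :
    x \in part q1_space i -> y \in part q1_space j ->
  q1_br x (q1_br y z)
    = q1_br (q1_br x y) z + (-1) ^+ (i && j) *: q1_br y (q1_br x z).
Proof.
move=> _ _; rewrite /q1_br /= !mulr0 mul0r mul0rn.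
by congr (_, _); rewrite scaler0 addr0.
Qed.

Definition q1 : lieSuperalgebra k :=
  LieSuperalgebra q1_br_linear_l q1_br_linear_r q1_br_graded q1_br_skew
    q1_br_jacobi.

End Q1.

(* Main.v *)
Require Import Defs.
From HB Require Import structures.
From mathcomp Require Import all_boot all_order all_algebra.
From mathcomp Require Import boolp.

(** Write e and t for the operators by which the basis of q(1) acts on a
    supermodule M; then t = e^2, and M belongs to the category F exactly when t
    is diagonalisable ([inF_spectral], [spectral_inF]).  On the nonzero
    eigenspaces of t the operator e is invertible, and on the kernel of t it is
    a differential, so M behaves like a complex whose homology lives on the
    kernel of t.  Everything is expressed by homotopies: linear maps s with
    f = e s + s e.  If f commutes with e, then s commutes with t.

    A supermodule of F is projective exactly when its identity is homotopic to
    zero: a contraction turns a t-equivariant lift into an e-equivariant one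
    ([contractible_projective]), and conversely a projective supermodule is a
    retract of the supermodule induced from the even part, which has an obvious
    contraction ([projective_contractible]).  For the same reason a morphism
    factors through a projective exactly when it is homotopic to zero, so the
    stable category is a homotopy category ([stable_isoP]).

    Say that M is of line type i if its identity is homotopic to a projection
    onto a line of degree i killed by e, along a hyperplane containing the image
    of e; that is, if its homology is one-dimensional of degree i.  This notion
    determines the stable class, is stably invariant, determines i, is preserved
    by duality, and i is additive under tensor products.  For a supermodule of
    line type 0, the kernel of the projection is contractible, so the
    supermodule is k_ev plus a projective ([line_type_iso]).  Applied to
    M (x) M^*, this shows that supermodules of line type are endotrivial.

    Conversely ([endomorphism_line_type]), the identity of any M in F is
    homotopic to an even idempotent p with e p = p e = 0 ([splitting]).  If
    p = 0, then M (x) M^* is contractible; if p has rank at least two, then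
    M (x) M^* has two cycles and two functionals vanishing on the image of e
    which are dual to each other.  Both contradict the line type of M (x) M^*,
    so p has rank one and M is of line type.

    Hence the degree of the homology line identifies T(q(1)) with Z/2. *)

Set Implicit Arguments.
Unset Strict Implicit.
Unset Printing Implicit Defensive.

Import GRing.Theory.
Import VectorInternalTheory.

Local Open Scope ring_scope.

(** * Linear algebra *)

Section LinearAlgebra.

Variable k : fieldType.

Definition lfun_of (U V : vectType k) (f : U -> V) (fL : linear f) :
    'Hom(U, V) :=
  linfun (HB.pack_for {linear U -> V} f (GRing.isLinear.Build _ _ _ _ f fL)).

Lemma lfun_ofE (U V : vectType k) (f : U -> V) (fL : linear f) :
  lfun_of fL =1 f.
Proof. by move=> u; rewrite lfunE. Qed.

Lemma lfun_exists (U V : vectType k) (f : U -> V) :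
  linear f -> exists h : 'Hom(U, V), h =1 f.
Proof. by move=> fL; exists (lfun_of fL); apply: lfun_ofE. Qed.

Lemma scaler_linear_l (V : vectType k) (x : V) : linear (fun a : k^o => a *: x).
Proof. by move=> a b c; rewrite scalerDl scalerA. Qed.

Lemma functional_exists (V : vectType k) (x : V) :
  x != 0 -> exists f : dual_vs V, f x = 1.
Proof.
move=> x0; pose c := lfun_of (scaler_linear_l x).
have c_inj : lker c == 0%VS.
  apply/lker0P => a b; rewrite !lfun_ofE => /eqP.
  by rewrite -subr_eq0 -scalerBl scaler_eq0 (negPf x0) orbF subr_eq0 => /eqP.
exists (c^-1)%VF; have := lker0_lfunK c_inj (1 : k^o).
by rewrite lfun_ofE scale1r.
Qed.

Lemma free_subseq_span (V : vectType k) (X : seq V) :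
  exists Y : seq V, [/\ {subset Y <= X}, free Y & <<Y>>%VS = <<X>>%VS].
Proof.
elim: X => [|v X [Y [YX Yf Ys]]]; first by exists [::]; rewrite nil_free.
have [vY|vY] := boolP (v \in <<Y>>%VS).
  exists Y; split=> //; first by move=> y /YX yX; rewrite inE yX orbT.
  rewrite span_cons Ys; apply/esym/addv_idPr.
  by rewrite -memvE -Ys.
exists (v :: Y); split; last by rewrite !span_cons Ys.
  by move=> y; rewrite !inE => /orP[->//|/YX ->]; rewrite orbT.
by rewrite free_cons vY.
Qed.

End LinearAlgebra.

(** Coordinates turn [f] into a matrix acting on row vectors, whose
    characteristic polynomial has a root since [u] makes its size positive. *)
Lemma eigenvector_exists (k : closedFieldType) (V : vectType k)
    (f : 'End(V)) (u : V) :
  u != 0 -> exists (a : k) (v : V), v != 0 /\ f v = a *: v.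
Proof.
move=> u0; have dim_gt0 : (0 < dim V)%N.
  rewrite lt0n; apply/negP => /eqP d0; case/negP: u0; apply/eqP.
  apply: (can_inj v2rK); apply/rowP => i; have := ltn_ord i.
  by rewrite [X in (_ < X)%N]d0.
have /closed_rootP[a] : size (char_poly (f2mx f)) != 1%N.
  by rewrite size_char_poly eqSS -lt0n.
rewrite -eigenvalue_root_char => /eigenvalueP[v vA v0].
exists a, (r2v v); split.
  by apply: contra v0 => /eqP/(congr1 (@v2r _ _)); rewrite r2vK linear0 => ->.
by apply: (can_inj v2rK); rewrite v2r_lfun linearZ /= r2vK.
Qed.

(** * Parity *)

Section Parity.

Variables (k : fieldType) (two_neq0 : 2%:R != 0 :> k).
Implicit Types (U V : superspace k) (i : bool).

(** Parity is expressed through the involution [sgr true] instead of the two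
    graded parts: in characteristic other than 2 this is equivalent
    ([even_map_part], [odd_map_part]), and conjugation by the involution splits
    every linear map into an even and an odd part. *)
Definition even_map U V (f : 'Hom(U, V)) : Prop :=
  forall v, f (sgr U true v) = sgr V true (f v).

Definition odd_map U V (f : 'Hom(U, V)) : Prop :=
  forall v, f (sgr U true v) = - sgr V true (f v).

Lemma sgrK U (v : U) : sgr U true (sgr U true v) = v.
Proof. by rewrite sgr_sgr /= sgrE expr0 scale1r proj_sum. Qed.

Lemma scale2_inj (V : vectType k) (u v : V) : u *+ 2 = v *+ 2 -> u = v.
Proof. by rewrite -!scaler_nat => /(scalerI two_neq0). Qed.

Lemma scale2K (V : vectType k) (v : V) : 2%:R^-1 *: (v + v) = v.
Proof. by rewrite -mulr2n -scaler_nat scalerK. Qed.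

Lemma sgr_true_part U i (v : U) :
  v \in part U i -> sgr U true v = (-1) ^+ i *: v.
Proof. exact: sgr_part. Qed.

Lemma part_sgr U i (v : U) : sgr U true v = (-1) ^+ i *: v -> v \in part U i.
Proof.
have := proj_sum v => /esym v01; rewrite sgrE {3}v01 scalerDr.
rewrite mem_partE; case: i => /=; rewrite !expr1 ?expr0 ?scale1r !scaleN1r.
  move/addIr/esym/eqP; rewrite -subr_eq0 -opprD oppr_eq0 -mulr2n -scaler_nat.
  by rewrite scaler_eq0 (negPf two_neq0) {3}v01 => /eqP ->; rewrite add0r.
move/addrI/esym/eqP; rewrite -subr_eq0 opprK -mulr2n -scaler_nat.
by rewrite scaler_eq0 (negPf two_neq0) {3}v01 => /eqP ->; rewrite addr0.
Qed.

Lemma even_map_part U V (f : 'Hom(U, V)) :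
  even_map f <-> forall i v, v \in part U i -> f v \in part V i.
Proof.
split=> [fe i v vi|fp v].
  by apply: part_sgr; rewrite -fe (sgr_true_part vi) linearZ.
have fproj i : f (sgr U true (proj U i v)) = sgr V true (f (proj U i v)).
  by rewrite sgr_proj linearZ (sgr_part _ (fp _ _ (mem_proj i v))).
by rewrite -(proj_sum v) !linearD /= !fproj.
Qed.

Lemma odd_map_part U V (f : 'Hom(U, V)) :
  odd_map f <-> forall i v, v \in part U i -> f v \in part V (~~ i).
Proof.
split=> [fo i v vi|fp v].
  apply: part_sgr; rewrite -[LHS]opprK -fo (sgr_true_part vi) linearZ /= signrN.
  by rewrite scaleNr.
have fproj i : f (sgr U true (proj U i v)) = - sgr V true (f (proj U i v)).
  rewrite sgr_proj linearZ (sgr_part _ (fp _ _ (mem_proj i v))) /=.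
  by rewrite signrN scaleNr opprK.
by rewrite -(proj_sum v) !linearD /= !fproj.
Qed.

Definition even_part U V (f : 'Hom(U, V)) : 'Hom(U, V) :=
  2%:R^-1 *: (f + (sgr V true \o f \o sgr U true))%VF.

Definition odd_part U V (f : 'Hom(U, V)) : 'Hom(U, V) :=
  2%:R^-1 *: (f - (sgr V true \o f \o sgr U true))%VF.

Lemma even_partE U V (f : 'Hom(U, V)) v :
  even_part f v = 2%:R^-1 *: (f v + sgr V true (f (sgr U true v))).
Proof. by rewrite scale_lfunE add_lfunE !comp_lfunE. Qed.

Lemma odd_partE U V (f : 'Hom(U, V)) v :
  odd_part f v = 2%:R^-1 *: (f v - sgr V true (f (sgr U true v))).
Proof. by rewrite scale_lfunE add_lfunE opp_lfunE !comp_lfunE. Qed.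

Lemma even_part_even U V (f : 'Hom(U, V)) : even_map (even_part f).
Proof.
move=> v; rewrite !even_partE sgrK linearZ /=.
by rewrite [sgr V true (_ + _)]linearD /= sgrK addrC.
Qed.

Lemma odd_part_odd U V (f : 'Hom(U, V)) : odd_map (odd_part f).
Proof.
move=> v; rewrite !odd_partE sgrK linearZ /=.
by rewrite [sgr V true (_ - _)]linearB /= sgrK -scalerN opprB.
Qed.

End Parity.

(** * Supermodules over q(1) *)

(** Sealed, together with [t_op]: both are the action of a pair of scalars, and
    unification would otherwise compare the two by computing in the field. *)
HB.lock Definition e_op (k : fieldType) (M : supermodule (q1 k)) : 'End(M) :=
  act M (q1_e k : q1 k).

HB.lock Definition t_op (k : fieldType) (M : supermodule (q1 k)) : 'End(M) :=
  act M (q1_t k : q1 k).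

Arguments e_op {k M}.
Arguments t_op {k M}.

Section Operators.

Variables (k : fieldType) (two_neq0 : 2%:R != 0 :> k).
Implicit Types M N : supermodule (q1 k).

Lemma e_opE M : e_op = act M (q1_e k : q1 k).
Proof. exact: (congr1 (fun f => f k M) (@e_op.unlock)). Qed.

Lemma t_opE M : t_op = act M (q1_t k : q1 k).
Proof. exact: (congr1 (fun f => f k M) (@t_op.unlock)). Qed.

Lemma q1_e_part : (q1_e k : q1 k) \in part (q1 k) true.
Proof. exact: memv_line. Qed.

Lemma q1_t_part : (q1_t k : q1 k) \in part (q1 k) false.
Proof. exact: memv_line. Qed.

Lemma act_q1 M (x : q1 k) (v : M) : act M x v = x.1 *: t_op v + x.2 *: e_op v.
Proof.
have -> : x = x.1 *: (q1_t k : q1 k) + x.2 *: (q1_e k : q1 k).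
  case: x => a b; congr (_, _); rewrite /= /GRing.scale /= ?mulr0 ?mulr1.
    by rewrite addr0.
  by rewrite add0r.
rewrite actD !actZ e_opE t_opE add_lfunE !scale_lfunE /= /GRing.scale /=.
by rewrite !mulr0 !mulr1 addr0 add0r.
Qed.

(** The relation [e, e] = 2 t acts as 2 e^2 = 2 t. *)
Lemma t_op_sq M (v : M) : t_op v = e_op (e_op v).
Proof.
apply: (scale2_inj two_neq0).
rewrite !e_opE t_opE; have := act_brE v q1_e_part q1_e_part.
rewrite [br _ _]q1_br_ee mulr2n actD add_lfunE -!mulr2n => ->.
by rewrite expr1 scaleN1r opprK mulr2n.
Qed.

Lemma e_op_odd M : odd_map (@e_op k M).
Proof.
by move=> v; rewrite e_opE (act_sgr true v q1_e_part) expr1 scaleN1r.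
Qed.

Lemma is_homP M N (f : 'Hom(M, N)) :
  is_hom f <-> even_map f /\ forall v : M, f (e_op v) = e_op (f v).
Proof.
split=> [[fp fa]|[fe fc]].
  by split=> [|v]; [apply/even_map_part|rewrite !e_opE; exact: fa].
split=> [|x v]; first exact/even_map_part.
by rewrite !act_q1 linearD !linearZ /= !t_op_sq !fc.
Qed.

End Operators.

Section FromOddOperator.

Variables (k : fieldType) (V : superspace k) (e : 'End(V)).
Hypothesis e_odd : forall i v, v \in part V i -> e v \in part V (~~ i).

(** U(q(1)) is generated by e, with t = e^2, and e is subject to no relation:
    any odd operator defines a supermodule. *)
Definition q1_act (x : q1 k) : 'End(V) := x.1 *: (e \o e)%VF + x.2 *: e.

Lemma q1_actE x v : q1_act x v = x.1 *: e (e v) + x.2 *: e v.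
Proof. by rewrite add_lfunE !scale_lfunE comp_lfunE. Qed.

Fact q1_act_linear : linear q1_act.
Proof.
move=> a x y; rewrite /q1_act -[(a *: x + y).1]/(a * x.1 + y.1).
rewrite -[(a *: x + y).2]/(a * x.2 + y.2).
by rewrite !scalerDl scalerDr !scalerA addrACA.
Qed.

Fact q1_act_graded i j x v : x \in part (q1 k) i -> v \in part V j ->
  q1_act x v \in part V (i (+) j).
Proof.
rewrite [_ \in _]q1_partE => xi vj; rewrite q1_actE; case: i xi => /eqP ->.
  by rewrite scale0r add0r memvZ // e_odd.
by rewrite scale0r addr0 memvZ //= -[j]negbK !e_odd.
Qed.

Fact q1_act_br i j x y : x \in part (q1 k) i -> y \in part (q1 k) j ->
  q1_act (br x y) = (q1_act x \o q1_act y
    - (-1) ^+ (i && j) *: (q1_act y \o q1_act x))%VF.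
Proof.
move=> xi yj; apply/lfunP => v; rewrite lfun_brE !q1_actE /= scale0r addr0.
move: xi yj; rewrite ![_ \in _]q1_partE; case: i j => [] [] /eqP -> /eqP ->;
  rewrite /= !(scale0r, addr0, add0r, mulr0, mul0r, mul0rn);
  rewrite !(expr0, expr1, scale1r).
- rewrite scaleN1r opprK !linearZ /= !scalerA [y.2 * _]mulrC -scalerDl.
  by rewrite mulr2n.
- by rewrite !linearZ /= !scalerA ?scalerN ?subrr // mulrC subrr.
- by rewrite !linearZ /= !scalerA ?scalerN ?subrr // mulrC subrr.
by rewrite !linearZ /= !scalerA ?scalerN ?subrr // mulrC subrr.
Qed.

Definition q1_mod : supermodule (q1 k) :=
  Supermodule q1_act_linear q1_act_graded q1_act_br.

Lemma q1_mod_e (v : q1_mod) : e_op v = e v.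
Proof. by rewrite e_opE /= q1_actE /= scale0r add0r scale1r. Qed.

End FromOddOperator.

(** * Complete reducibility over the even part *)

Section Graded.

Variables (k : fieldType) (M : supermodule (q1 k)).

Lemma graded_vsP (W : {vspace M}) :
  graded_vs W <-> forall i w, w \in W -> proj M i w \in W.
Proof.
split=> [WE i w|Wp].
  have -> : (w \in W) = (w \in (W :&: part M false + W :&: part M true)%VS).
    by rewrite -WE.
  case/memv_addP=> [u uW [v vW ->]].
  move: uW vW; rewrite !memv_cap => /andP[uW u0] /andP[vW v1].
  rewrite linearD /= (proj_part _ u0) (proj_part _ v1).
  by case: i; rewrite /= ?add0r ?addr0.
apply/vspaceP => w; apply/idP/memv_addP => [wW|[u uW [v vW ->]]].
  exists (proj M false w); first by rewrite memv_cap Wp ?mem_proj.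
  by exists (proj M true w); rewrite ?proj_sum // memv_cap Wp ?mem_proj.
by move: uW vW; rewrite !memv_cap => /andP[uW _] /andP[vW _]; rewrite memvD.
Qed.

Lemma even_subP (W : {vspace M}) :
  even_sub W <-> (forall i w, w \in W -> proj M i w \in W) /\
                 (forall w, w \in W -> t_op w \in W).
Proof.
split=> [[/graded_vsP Wp Wt]|[Wp Wt]].
  by split=> // w wW; rewrite t_opE Wt ?q1_t_part.
split=> [|x w]; first exact/graded_vsP.
rewrite [_ \in _]q1_partE => /eqP x0 wW.
by rewrite act_q1 x0 scale0r addr0 memvZ ?Wt.
Qed.

Lemma t_op_proj i (v : M) : t_op (proj M i v) = proj M i (t_op v).
Proof. by rewrite t_opE (act_proj i v (q1_t_part k)) addFb. Qed.

End Graded.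

(** Diagonalisability of t, given as a resolution of the identity. The [l i]
    may repeat and the [p i] need not be idempotent, so that duals, tensor
    products and retracts inherit such a resolution by a direct formula. *)
Definition spectral (k : fieldType) (M : supermodule (q1 k)) : Prop :=
  exists (I : finType) (l : I -> k) (p : I -> 'End(M)),
    [/\ forall v, \sum_i p i v = v,
        forall i v, t_op (p i v) = l i *: p i v
      & forall i v, p i (t_op v) = l i *: p i v].

(** Schur: t has an eigenvector in [S], and the corresponding eigenspace of t
    in [S] is graded and t-stable because t is even, hence equal to [S]. *)
Lemma even_simple_scalar (k : closedFieldType) (M : supermodule (q1 k))
    (S : {vspace M}) :
  even_simple S -> exists a : k, forall w, w \in S -> t_op w = a *: w.
Proof.
case=> /even_subP[Sp St] /eqP S0 Smin.
have [u0 uS] : vpick S != 0 /\ vpick S \in S by rewrite vpick0 S0 memv_pick.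
pose f : 'End(subvs_of S) :=
  (linfun (vsproj S) \o t_op \o linfun (vsval : subvs_of S -> M))%VF.
have fE (x : subvs_of S) : vsval (f x) = t_op (vsval x).
  by rewrite !comp_lfunE !lfunE /= vsprojK // St ?subvsP.
have [|a [x [x0 fx]]] := @eigenvector_exists _ _ f (vsproj S (vpick S)).
  by apply: contra u0 => /eqP/(congr1 vsval); rewrite vsprojK // linear0 => ->.
have tx : t_op (vsval x) = a *: vsval x by rewrite -fE fx linearZ.
pose W := (S :&: lker (t_op - a *: \1%VF))%VS.
have memW w : (w \in W) = (w \in S) && (t_op w == a *: w).
  rewrite memv_cap memv_ker add_lfunE opp_lfunE scale_lfunE id_lfunE.
  by rewrite subr_eq0.
exists a => w wS; have W_sub : even_sub W.
  apply/even_subP; split=> [i v|v]; rewrite !memW => /andP[vS /eqP tv].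
    by rewrite Sp //= t_op_proj tv linearZ.
  by rewrite St //= tv linearZ /= tv.
have [W0|WS] := Smin W W_sub (capvSl _ _).
  have : vsval x \in W by rewrite memW subvsP tx eqxx.
  by rewrite W0 memv0 (inj_eq (@subvs_inj _ _ _) x 0) (negPf x0).
by move: wS; rewrite -WS memW => /andP[_ /eqP].
Qed.

Lemma inF_spectral (k : closedFieldType) (M : supermodule (q1 k)) :
  inF M -> spectral M.
Proof.
case=> n [S [S_simple S_direct S_full]].
have [l lP] := fin_all_exists (fun i => even_simple_scalar (S_simple i)).
pose p i : 'End(M) := sumv_pi_for (esym S_full) i.
have pS i v : p i v \in S i by apply: memv_sum_pi.
have psum v : \sum_i p i v = v by rewrite sumv_pi_sum ?memvf.
exists 'I_n, l, p; split=> // [i v|i v]; first exact/lP/pS.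
have /directv_sum_unique/(_ (p^~ (t_op v)) (fun j => l j *: p j v)) := S_direct.
(* Both families decompose [t_op v] along the direct sum of the [S j]. *)
rewrite psum; have -> : \sum_j l j *: p j v = t_op v.
  rewrite -[in RHS](psum v) linear_sum.
  by apply: eq_bigr => j _ /=; rewrite (lP j).
rewrite eqxx => eqS; apply/eqP; move: i.
by apply/forallP; rewrite -eqS // => j _; rewrite ?memvZ.
Qed.

(** The homogeneous components of the vectors [p j b], with [b] in a basis, are
    eigenvectors of t and span [M]; a basis extracted from them decomposes [M]
    into lines that are simple over the even part. *)
Lemma spectral_inF (k : fieldType) (M : supermodule (q1 k)) :
  spectral M -> inF M.
Proof.
case=> I [l [p [psum tp _]]].
pose X := [seq proj M c jb | c <- [:: false; true],
  jb <- [seq p j b | j <- enum I, b <- vbasis {:M}]].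
have X_eigen v : v \in X -> exists c a, v \in part M c /\ t_op v = a *: v.
  case/allpairsP => -[c _] [_ /allpairsP[[j b] [_ _ ->]] ->] /=.
  by exists c, (l j); rewrite mem_proj t_op_proj tp linearZ.
have X_full : <<X>>%VS = fullv.
  apply/eqP; rewrite eqEsubv subvf /=.
  rewrite -(span_basis (vbasisP {:M})); apply/span_subvP => b bB.
  rewrite -(psum b) memv_suml // => j _; rewrite -(proj_sum (p j b)).
  have pX c : proj M c (p j b) \in <<X>>%VS.
    apply/memv_span/allpairs_f; first by case: c.
    by apply/allpairs_f => //; rewrite mem_enum.
  by rewrite memvD.
have [Y [YX Yfree Yspan]] := free_subseq_span X.
have Y0 i : (i < size Y)%N -> Y`_i != 0.
  by move=> iY; rewrite (free_not0 Yfree) ?mem_nth.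
have Ysum : (\sum_(i < size Y) <[Y`_i]>)%VS = fullv.
  by rewrite -X_full -Yspan span_def (big_nth 0) big_mkord.
exists (size Y), (fun i => <[Y`_i]>%VS); split=> // [i|].
  have [c [a [vc tv]]] := X_eigen _ (YX _ (mem_nth 0 (ltn_ord i))).
  split.
  - apply/even_subP; split=> [j w|w] /vlineP[b ->].
      rewrite linearZ memvZ //= (proj_part _ vc).
      by case: eqP => _; rewrite ?memv_line ?mem0v.
    by rewrite linearZ memvZ //= tv memvZ ?memv_line.
  - by move/eqP; rewrite -dimv_eq0 dim_vline Y0.
  move=> W _ WY; have := dimvS WY; rewrite dim_vline Y0 // leq_eqVlt ltnS leqn0.
  case/orP=> [/eqP W1|]; last by rewrite dimv_eq0 => /eqP; left.
  by right; apply/eqP; rewrite eqEdim WY W1 dim_vline Y0.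
rewrite directvE /= Ysum -X_full -Yspan (eqP Yfree).
rewrite (eq_bigr (fun=> 1%N)) ?sum1_card ?card_ord // => i _.
by rewrite dim_vline Y0.
Qed.

Section Spectral.

Variable k : fieldType.
Implicit Types M N : supermodule (q1 k).

Lemma spectral_ext M (V : vectType k) (f h : 'Hom(M, V)) :
    spectral M -> (forall a w, t_op w = a *: w -> f w = h w) ->
  forall v, f v = h v.
Proof.
case=> I [l [p [psum tp _]]] eqfh v; rewrite -(psum v) !linear_sum.
by apply: eq_bigr => i _; apply: eqfh (tp i v).
Qed.

(** A functional calculus: [F c] is the operator c(t), which acts on the
    eigenspace of t for [a] as the scalar [c a]. *)
Definition calculus M (F : (k -> k) -> 'End(M)) : Prop :=
  forall c a w, t_op w = a *: w -> F c w = c a *: w.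

(** c(t) is the sum of the [c (l i) *: p i]. On an eigenvector for [a] the only
    [p i] that do not vanish are those with [l i = a]. *)
Lemma calculus_exists M : spectral M -> exists F, @calculus M F.
Proof.
case=> I [l [p [psum tp pt]]].
exists (fun c => \sum_i c (l i) *: p i) => c a w tw.
rewrite sum_lfunE -{2}(psum w) scaler_sumr; apply: eq_bigr => i _.
rewrite scale_lfunE; have [->//|nla] := eqVneq (l i) a.
have : (l i - a) *: p i w = 0 by rewrite scalerBl -pt tw linearZ /= subrr.
move/eqP; rewrite scaler_eq0 subr_eq0 (negPf nla) => /eqP ->.
by rewrite !scaler0.
Qed.

(** A t-equivariant map preserves eigenvectors and their eigenvalues. *)
Lemma calculus_natural M N (f : 'Hom(M, N)) F G c v :
    spectral M -> @calculus M F -> @calculus N G ->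
    (forall v, f (t_op v) = t_op (f v)) ->
  f (F c v) = G c (f v).
Proof.
move=> Ms FP GP ft.
have := @spectral_ext M N (f \o F c)%VF (G c \o f)%VF Ms.
move=> /(_ _ v); rewrite !comp_lfunE; apply=> a w tw.
by rewrite !comp_lfunE (FP _ _ _ tw) (GP c a) -?ft ?tw linearZ.
Qed.

Lemma spectral_retract M N (i : 'Hom(N, M)) (r : 'Hom(M, N)) :
    (forall v, i (t_op v) = t_op (i v)) ->
    (forall v, r (t_op v) = t_op (r v)) ->
    cancel i r ->
  spectral M -> spectral N.
Proof.
move=> it rt irK [I [l [p [psum tp pt]]]].
exists I, l, (fun j => r \o p j \o i)%VF; split=> [v|j v|j v].
- rewrite -[RHS](irK v) -[in RHS](psum (i v)) linear_sum.
  by apply: eq_bigr => j _; rewrite !comp_lfunE.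
- by rewrite !comp_lfunE -rt tp linearZ.
by rewrite !comp_lfunE it pt linearZ.
Qed.

Lemma e_dual M (f : dual_mod M) (v : M) :
  (e_op f : dual_vs M) v = - (f : dual_vs M) (sgr M true (e_op v)).
Proof. by rewrite !e_opE; apply: dual_act_hom; apply: q1_e_part. Qed.

Lemma t_dual M (f : dual_mod M) (v : M) :
  (t_op f : dual_vs M) v = - (f : dual_vs M) (t_op v).
Proof.
rewrite !t_opE [LHS](dual_act_hom _ _ (q1_t_part k)).
by rewrite sgrE expr0 scale1r proj_sum.
Qed.

Lemma spectral_dual M : spectral M -> spectral (dual_mod M).
Proof.
case=> I [l [p [psum tp pt]]].
exists I, (fun i => - l i), (fun i => precomp (p i)); split=> [f|i f|i f].
- apply/lfunP => v; rewrite sum_lfunE -{2}(psum v) linear_sum.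
  by apply: eq_bigr => i _; rewrite precompE comp_lfunE.
- apply/lfunP => v; rewrite t_dual scale_lfunE precompE !comp_lfunE.
  by rewrite pt linearZ scaleNr.
apply/lfunP => v; rewrite precompE comp_lfunE t_dual scale_lfunE precompE.
by rewrite comp_lfunE tp linearZ scaleNr.
Qed.

Lemma e_tens M N (u : M) (v : N) :
  e_op (tens u v : tens_mod M N) =
    tens (e_op u) v + tens (sgr M true u) (e_op v).
Proof. by rewrite !e_opE; apply: tens_act_hom; apply: q1_e_part. Qed.

Lemma t_tens M N (u : M) (v : N) :
  t_op (tens u v : tens_mod M N) = tens (t_op u) v + tens u (t_op v).
Proof.
rewrite !t_opE [LHS](tens_act_hom _ _ (q1_t_part k)).
by rewrite sgrE expr0 scale1r proj_sum.
Qed.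

Lemma tens_suml (U V : vectType k) (I : finType) (f : I -> U) (v : V) :
  tens (\sum_i f i) v = \sum_i tens (f i) v.
Proof.
by apply: (big_morph (fun x => tens x v)) => [x y|]; rewrite ?tensDl ?tens0l.
Qed.

Lemma tens_sumr (U V : vectType k) (I : finType) (u : U) (f : I -> V) :
  tens u (\sum_i f i) = \sum_i tens u (f i).
Proof. by apply: (big_morph (tens u)) => [x y|]; rewrite ?tensDr ?tens0r. Qed.

Lemma spectral_tens M N : spectral M -> spectral N -> spectral (tens_mod M N).
Proof.
case=> I [l [p [psum tp pt]]] [J [m [q [qsum tq qt]]]].
pose pq (ij : I * J) : 'End(tens_mod M N) := tmap (p ij.1) (q ij.2).
exists (I * J)%type, (fun ij => l ij.1 + m ij.2), pq.
split=> [X|[i j] X|[i j] X].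
- have : \sum_ij pq ij = \1%VF.
    apply: tens_ext => u v; rewrite id_lfunE sum_lfunE.
    rewrite -{2}(psum u) tens_suml -{2}(qsum v).
    under [RHS]eq_bigr do rewrite tens_sumr.
    by rewrite pair_bigA; apply: eq_bigr => -[i j] _; rewrite /pq tmap_tens.
  by rewrite -sum_lfunE => ->; rewrite id_lfunE.
- rewrite -comp_lfunE -scale_lfunE; move: X; apply/lfunP/tens_ext => u v.
  rewrite comp_lfunE scale_lfunE /pq /= !tmap_tens t_tens tp tq.
  by rewrite tensZl tensZr scalerDl.
rewrite -comp_lfunE -scale_lfunE; move: X; apply/lfunP/tens_ext => u v.
rewrite comp_lfunE scale_lfunE t_tens linearD /pq /= !tmap_tens pt qt.
by rewrite tensZl tensZr scalerDl.
Qed.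

End Spectral.

(** * Homotopies *)

Section Homotopy.

Variables (k : fieldType) (two_neq0 : 2%:R != 0 :> k).
Implicit Types M N P Q : supermodule (q1 k).

(** Any linear [s] is allowed: when [f] is even, the odd part of [s] is again a
    homotopy ([homotopy_odd]). *)
Definition homotopy M N (s f : 'Hom(M, N)) : Prop :=
  forall v, f v = e_op (s v) + s (e_op v).

Definition contractible M : Prop := exists s : 'End(M), homotopy s \1%VF.

Lemma even_part_id (U V : superspace k) (f : 'Hom(U, V)) v :
  even_map f -> even_part f v = f v.
Proof. by move=> fe; rewrite even_partE -fe sgrK (scale2K two_neq0). Qed.

Lemma sgr_e M (v : M) : sgr M true (e_op v) = - e_op (sgr M true v).
Proof. by rewrite (e_op_odd v) opprK. Qed.

Lemma homotopy_odd M N (s f : 'Hom(M, N)) :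
  homotopy s f -> homotopy (odd_part s) (even_part f).
Proof.
move=> sf v; rewrite even_partE !odd_partE !sf [sgr N true (_ + _)]linearD /=.
rewrite sgr_e (e_op_odd v) !linearN linearZ /= linearB /= -scalerDr.
by congr (_ *: _); rewrite addrACA.
Qed.

(** Comparing f e = e s e + s e^2 with e f = e^2 s + e s e. *)
Lemma homotopy_t M N (s f : 'Hom(M, N)) :
    homotopy s f -> (forall v, f (e_op v) = e_op (f v)) ->
  forall v, s (t_op v) = t_op (s v).
Proof.
move=> sf fe v; have := fe v; rewrite !sf linearD /= addrC => /addIr.
by rewrite -!(t_op_sq two_neq0).
Qed.

Lemma homotopy_comp M N P Q
    (s f : 'Hom(N, P)) (a : 'Hom(M, N)) (b : 'Hom(P, Q)) :
    (forall v, a (e_op v) = e_op (a v)) ->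
    (forall v, b (e_op v) = e_op (b v)) ->
  homotopy s f -> homotopy (b \o s \o a)%VF (b \o f \o a)%VF.
Proof. by move=> ae be sf v; rewrite !comp_lfunE sf linearD /= be ae. Qed.

(** Every object of F deforms onto its homology. Let p0 be the projection onto
    the kernel of t and r the inverse of t on the other eigenspaces. There e r
    / 2 is a contraction, since e (e r) + (e r) e = 2 t r. On the kernel of t
    the map d = e p0 squares to zero, and a generalised inverse h of d, with d
    h d = d, gives the homotopy p0 h p0. The resulting map p1 satisfies e p1 =
    p1 e = 0, but need be neither even nor idempotent. *)
Lemma splitting M : spectral M ->
  exists s p : 'End(M),
    [/\ odd_map s, even_map p & homotopy s (\1 - p)%VF] /\
    [/\ forall v, e_op (p v) = 0, forall v, p (e_op v) = 0
      & forall v, p (p v) = p v].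
Proof.
move=> Ms; have [F FP] := calculus_exists Ms.
have Fe c (v : M) : F c (e_op v) = e_op (F c v).
  apply/esym; apply: (calculus_natural (f := e_op) c v Ms FP FP) => w.
  by rewrite !(t_op_sq two_neq0).
pose p0 := F (fun a => (a == 0)%:R); pose r := F (fun a => a^-1).
have tp0 v : e_op (e_op (p0 v)) = 0.
  rewrite -(t_op_sq two_neq0) -comp_lfunE -[RHS](@zero_lfunE _ M M v).
  apply: (spectral_ext Ms) => a w tw.
  rewrite comp_lfunE zero_lfunE (FP _ _ _ tw).
  rewrite linearZ /= tw scalerA; case: (eqVneq a 0) => [->|_].
    by rewrite mulr0 scale0r.
  by rewrite mul0r scale0r.
have tr v : e_op (e_op (r v)) = v - p0 v.
  have := @spectral_ext _ M M (t_op \o r)%VF (\1 - p0)%VF Ms _ v.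
  rewrite comp_lfunE (t_op_sq two_neq0) add_lfunE opp_lfunE id_lfunE; apply.
  move=> a w tw; rewrite comp_lfunE add_lfunE opp_lfunE id_lfunE !(FP _ _ _ tw).
  rewrite linearZ /= tw scalerA; case: (eqVneq a 0) => [->|a0].
    by rewrite invr0 mul0r scale0r scale1r subrr.
  by rewrite mulVf // scale1r scale0r subr0.
pose d := (e_op \o p0)%VF; pose h := (d^-1)%VF.
have dE v : d v = e_op (p0 v) by rewrite comp_lfunE.
have dhd v : d (h (d v)) = d v by apply/limg_lfunVK/memv_img/memvf.
pose s1 : 'End(M) := 2%:R^-1 *: (e_op \o r)%VF + (p0 \o h \o p0)%VF.
have s1E v : s1 v = 2%:R^-1 *: e_op (r v) + p0 (h (p0 v)).
  by rewrite add_lfunE scale_lfunE !comp_lfunE.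
pose p1 : 'End(M) := (\1 - ((e_op \o s1) + (s1 \o e_op)))%VF.
have p1E v : p1 v = p0 v - d (h (p0 v)) - p0 (h (d v)).
  rewrite /p1 add_lfunE opp_lfunE id_lfunE add_lfunE !comp_lfunE !s1E !Fe.
  rewrite [e_op (_ + _)]linearD /= [e_op (_ *: _)]linearZ /= addrACA -scalerDr.
  rewrite (scale2K two_neq0) tr -!dE.
  by rewrite !opprD opprK !addrA subrr add0r.
have ep1 v : e_op (p1 v) = 0.
  by rewrite p1E !linearB /= [d (h (p0 v))]dE tp0 subr0 -!dE dhd subrr.
have p1e v : p1 (e_op v) = 0.
  by rewrite p1E Fe -dE dhd subrr dE Fe tp0 !linear0 ?subr0 ?addr0.
have s1p1 : homotopy s1 (\1 - p1)%VF.
  move=> v; rewrite add_lfunE opp_lfunE id_lfunE /p1 add_lfunE opp_lfunE.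
  by rewrite id_lfunE opprB addrC addrNK add_lfunE !comp_lfunE.
(* The even part of p1 is still annihilated by e on both sides. *)
pose s2 := odd_part s1; pose p2 := even_part p1.
have s2p2 v : v - p2 v = e_op (s2 v) + s2 (e_op v).
  rewrite -(homotopy_odd s1p1) even_partE add_lfunE opp_lfunE !id_lfunE.
  rewrite (add_lfunE \1%VF) opp_lfunE id_lfunE linearB /= sgrK addrACA -opprD.
  by rewrite scalerBr (scale2K two_neq0) -even_partE.
have ep2 v : e_op (p2 v) = 0.
  rewrite even_partE linearZ linearD /= e_op_odd !ep1 linear0 oppr0.
  by rewrite addr0 scaler0.
have p2e v : p2 (e_op v) = 0.
  by rewrite even_partE sgr_e linearN /= !p1e oppr0 linear0 addr0 scaler0.
have p2_even : even_map p2 by apply: even_part_even.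
have s2_odd : odd_map s2 by apply: odd_part_odd.
clearbody s2 p2.
have p2p2 v : p2 (p2 v) = p2 v - e_op (s2 (p2 v)).
  by have := s2p2 (p2 v); rewrite ep2 linear0 addr0 => <-; rewrite subKr.
(* Since p2^2 = p2 - e s2 p2 and p2 kills the image of e, p2^3 = p2^2: so p2^2
   is idempotent, and s2 + s2 p2 is a homotopy from it to the identity. *)
pose s3 : 'End(M) := (s2 + (s2 \o p2))%VF.
have s3E v : s3 v = s2 v + s2 (p2 v) by rewrite add_lfunE comp_lfunE.
have p3E v : (p2 \o p2)%VF v = p2 (p2 v) by rewrite comp_lfunE.
clearbody s3; exists s3, (p2 \o p2)%VF; split; (split=> v).
- by rewrite !s3E p2_even !s2_odd linearD opprD.
- by rewrite !p3E !p2_even.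
- rewrite add_lfunE opp_lfunE id_lfunE p3E !s3E p2p2 p2e linear0 addr0.
  by rewrite [e_op (_ + _)]linearD /= addrAC -s2p2 opprB addrCA addrC.
- by rewrite p3E ep2.
- by rewrite p3E p2e linear0.
have p3p w : p2 (p2 (p2 w)) = p2 (p2 w).
  by rewrite {1}(p2p2 w) linearB /= p2e subr0.
by rewrite !p3E !p3p.
Qed.

End Homotopy.

(** * Induced supermodules, projectives and the stable category *)

Section Induced.

Variables (k : fieldType) (two_neq0 : 2%:R != 0 :> k).

Lemma sum_pair (U V : vectType k) (I : Type) (r : seq I)
    (f : I -> U) (h : I -> V) :
  \sum_(i <- r) ((f i, h i) : prod_vs U V) =
    (\sum_(i <- r) f i, \sum_(i <- r) h i).
Proof. by elim: r => [|i r IHr]; rewrite ?big_nil // !big_cons IHr. Qed.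

Section Shift.
Variable V : superspace k.

Definition shift_part (i : bool) : {vspace V} := part V (~~ i).

Fact shift_direct : (shift_part false :&: shift_part true = 0)%VS.
Proof. by rewrite capvC; apply: part_direct. Qed.

Fact shift_full : (shift_part false + shift_part true = fullv)%VS.
Proof. by rewrite addvC; apply: part_full. Qed.

Definition shift_space : superspace k := Superspace shift_direct shift_full.
End Shift.

Variable N : supermodule (q1 k).

Definition ind_space : superspace k := sum_space N (shift_space N).

Fact ind_op_linear :
  linear (fun w : ind_space => (t_op w.2, w.1) : ind_space).
Proof. by move=> a u v; rewrite /= linearP. Qed.

(** The pair (n, n') stands for 1 (x) n + e (x) n' in the induced supermodule
    U(q(1)) (x) N over the subalgebra spanned by t, so that e (n, n') = (t n',
    n). *)
Definition ind_op : 'End(ind_space) := lfun_of ind_op_linear.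

Fact ind_op_odd i v :
  v \in part ind_space i -> ind_op v \in part ind_space (~~ i).
Proof.
rewrite lfun_ofE ![_ \in part ind_space _]sum_partE /= /shift_part negbK.
case/andP=> -> v2.
by rewrite t_opE (act_graded (q1_t_part k) v2).
Qed.

Definition ind_mod : supermodule (q1 k) := q1_mod ind_op_odd.

Lemma e_ind (w : ind_mod) : e_op w = (t_op w.2, w.1).
Proof. by rewrite q1_mod_e; apply: lfun_ofE. Qed.

Lemma t_ind (w : ind_mod) : t_op w = (t_op w.1, t_op w.2).
Proof. by rewrite (t_op_sq two_neq0) !e_ind. Qed.

(** The contraction is (n, n') |-> (n', 0). *)
Lemma ind_contractible : contractible ind_mod.
Proof.
have [|s sE] := @lfun_exists _ ind_mod ind_mod (fun w => (w.2, 0)).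
  by move=> a u v; congr (_, _); rewrite /= scaler0 addr0.
exists s => w; rewrite id_lfunE !sE !e_ind /= linear0.
by case: w => u v; congr (_, _); rewrite /= ?add0r ?addr0.
Qed.

Lemma ind_spectral : spectral N -> spectral ind_mod.
Proof.
case=> I [l [p [psum tp pt]]].
exists I, l, (fun i => prod_map (p i) (p i)); split=> [w|i w|i w].
- transitivity (\sum_i ((p i w.1, p i w.2) : prod_vs N N)).
    by apply: eq_bigr => i _; rewrite prod_mapE.
  by rewrite sum_pair !psum; case: w.
- by rewrite t_ind prod_mapE /= !tp.
by rewrite t_ind !prod_mapE /= !pt.
Qed.

(** This is the action map x (x) n |-> x n of the induced supermodule. *)
Lemma ind_counit : exists b : 'Hom(ind_mod, N),
  is_hom b /\ forall w, b w = w.1 + e_op w.2.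
Proof.
have [|b bE] := @lfun_exists _ ind_mod N (fun w => w.1 + e_op w.2).
  by move=> a u v; rewrite /= linearP scalerDr addrACA.
exists b; split=> //; apply/(is_homP two_neq0); split=> [|w].
  apply/(even_map_part two_neq0) => i w.
  rewrite bE [_ \in part ind_mod _]sum_partE => /andP[w1 w2].
  rewrite memvD //; have := act_graded (q1_e_part k) w2.
  by rewrite -e_opE addTb negbK.
by rewrite !bE e_ind /= linearD /= -(t_op_sq two_neq0) addrC.
Qed.

(** The factorisation is v |-> (s e v, s v), followed by the action map (n, n')
    |-> n + e n'. It is e-equivariant because s commutes with t, and even
    because s can be taken odd. *)
Lemma ind_factor (M : supermodule (q1 k)) (s f : 'Hom(M, N)) :
    is_hom f -> homotopy s f ->
  exists (a : 'Hom(M, ind_mod)) (b : 'Hom(ind_mod, N)),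
    [/\ is_hom a, is_hom b & f = (b \o a)%VF].
Proof.
case/(is_homP two_neq0) => fe fc /homotopy_odd; set s1 := odd_part s => s1f.
have {}s1f : homotopy s1 f by move=> v; rewrite -s1f (even_part_id two_neq0).
have s1_odd : odd_map s1 by apply: odd_part_odd.
clearbody s1; have s1t := homotopy_t two_neq0 s1f fc.
have [|a aE] := @lfun_exists _ M ind_mod (fun v => (s1 (e_op v), s1 v)).
  by move=> c u v; rewrite !linearP.
have [b [b_hom bE]] := ind_counit.
exists a, b; split=> //; last first.
  by apply/lfunP => v; rewrite comp_lfunE bE aE /= s1f addrC.
apply/(is_homP two_neq0); split=> [|v]; last first.
  by rewrite !aE e_ind /= -s1t (t_op_sq two_neq0).
apply/(even_map_part two_neq0) => i v vi.
rewrite aE [_ \in part ind_mod _]sum_partE /= /shift_part.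
have s1_part := (odd_map_part two_neq0 s1).1 s1_odd.
rewrite (s1_part _ _ vi) andbT -[i]negbK s1_part // e_opE.
exact: (act_graded (q1_e_part k) vi).
Qed.

End Induced.

Section Projective.

Variables (k : closedFieldType) (two_neq0 : 2%:R != 0 :> k).
Implicit Types M N P : supermodule (q1 k).

(** Let h contract [P]. Lift f along D first to a t-equivariant g, by
    correcting a linear lift on each eigenspace of t; then f' = e (g h) + (g h)
    e commutes with e and satisfies D f' = e f h + f h e = f (e h + h e) = f.
    The even part of f' is the required lift. *)
Lemma contractible_projective P : spectral P -> contractible P -> projectiveF P.
Proof.
move=> Ps [h hP]; split=> [|M N D f Mf Nf D_hom D_full f_hom].
  exact: spectral_inF.
have [De Dc] := (is_homP two_neq0 D).1 D_hom.
have [fe fc] := (is_homP two_neq0 f).1 f_hom.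
have Ms := inF_spectral Mf; have Ns := inF_spectral Nf.
have [FM FMP] := calculus_exists Ms; have [FN FNP] := calculus_exists Ns.
have Dt v : D (t_op v) = t_op (D v) by rewrite !(t_op_sq two_neq0) !Dc.
have ft v : f (t_op v) = t_op (f v) by rewrite !(t_op_sq two_neq0) !fc.
have FMt c v : FM c (t_op v) = t_op (FM c v).
  by apply/esym/(calculus_natural c v Ms FMP FMP).
have [I [l [p [psum tp pt]]]] := Ps.
(* The indicator function of [l i] projects the linear lift onto the
   eigenspace for [l i], where [p i] takes its values. *)
pose g : 'Hom(P, M) :=
  \sum_i (FM (fun a => (a == l i)%:R) \o D^-1 \o f \o p i)%VF.
have gE v : g v = \sum_i FM (fun a => (a == l i)%:R) ((D^-1)%VF (f (p i v))).
  by rewrite sum_lfunE; apply: eq_bigr => i _; rewrite !comp_lfunE.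
have Dg v : D (g v) = f v.
  rewrite gE -[in RHS](psum v) !linear_sum; apply: eq_bigr => i _ /=.
  rewrite (calculus_natural _ _ Ms FMP FNP Dt) limg_lfunVK ?D_full ?memvf //.
  by rewrite (FNP _ (l i)) ?eqxx ?scale1r // -ft tp linearZ.
have gt v : g (t_op v) = t_op (g v).
  rewrite !gE linear_sum; apply: eq_bigr => i _ /=.
  rewrite pt -FMt !linearZ /=; set w := (D^-1)%VF _.
  have := @spectral_ext _ M M
    (FM (fun a => (a == l i)%:R) \o t_op)%VF
    (l i *: FM (fun a => (a == l i)%:R)) Ms.
  move=> /(_ _ w); rewrite comp_lfunE scale_lfunE => -> // a x tx.
  rewrite comp_lfunE scale_lfunE tx linearZ /= !(FMP _ _ _ tx) !scalerA.
  by case: eqVneq => [->|]; rewrite ?mulr0.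
clearbody g.
pose s := (g \o h)%VF; pose f1 := ((e_op \o s) + (s \o e_op))%VF.
have f1E v : f1 v = e_op (s v) + s (e_op v).
  by rewrite add_lfunE !comp_lfunE.
have ht v : h (t_op v) = t_op (h v).
  by apply: (homotopy_t two_neq0 hP) => w; rewrite !id_lfunE.
have st v : s (t_op v) = t_op (s v) by rewrite !comp_lfunE ht gt.
have f1c v : f1 (e_op v) = e_op (f1 v).
  by rewrite !f1E linearD /= -!(t_op_sq two_neq0) st addrC.
have Df1 v : D (f1 v) = f v.
  by rewrite f1E linearD /= Dc !comp_lfunE !Dg -fc -linearD -hP id_lfunE.
exists (even_part f1); split.
  apply/(is_homP two_neq0); split; first exact: even_part_even.
  move=> v; rewrite !even_partE [e_op (_ *: _)]linearZ /=.
  rewrite [e_op (_ + _)]linearD /=.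
  by rewrite [sgr P true (e_op v)]sgr_e !linearN /= !f1c e_op_odd.
apply/lfunP => v; rewrite comp_lfunE even_partE linearZ linearD /= De !Df1.
by rewrite -even_partE (even_part_id two_neq0).
Qed.

(** A projective is a retract of its induced supermodule. *)
Lemma projective_contractible P : projectiveF P -> contractible P.
Proof.
case=> Pf Pproj; have Ps := inF_spectral Pf.
have [b [b_hom bE]] := ind_counit two_neq0 P.
have b_full : limg b = fullv.
  apply/eqP; rewrite eqEsubv subvf; apply/subvP => v _.
  have <- : b ((v, 0) : ind_mod P) = v by rewrite bE /= linear0 addr0.
  exact/memv_img/memvf.
have id_hom : is_hom (\1%VF : 'End(P)).
  by apply/(is_homP two_neq0); split=> v; rewrite !id_lfunE.
have ind_F := spectral_inF (ind_spectral two_neq0 Ps).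
have [a [a_hom ab]] := Pproj _ _ b \1%VF ind_F Pf b_hom b_full id_hom.
have [s sP] := ind_contractible P.
exists (b \o s \o a)%VF.
have -> : \1%VF = (b \o \1 \o a)%VF by rewrite comp_lfun1r ab.
apply: homotopy_comp => // v; first by case/(is_homP two_neq0): a_hom.
by case/(is_homP two_neq0): b_hom.
Qed.

Lemma stably_equal_homotopy M N (f f' : 'Hom(M, N)) :
  stably_equal f f' -> exists s : 'Hom(M, N), homotopy s (f - f').
Proof.
case=> P [a [b [/projective_contractible[s sP] a_hom b_hom ->]]].
exists (b \o s \o a)%VF.
have -> : (b \o a = b \o \1 \o a)%VF by rewrite comp_lfun1r.
apply: homotopy_comp => // v; first by case/(is_homP two_neq0): a_hom.
by case/(is_homP two_neq0): b_hom.
Qed.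

Lemma homotopy_stably_equal M N (s f f' : 'Hom(M, N)) :
  spectral N -> is_hom (f - f') -> homotopy s (f - f') -> stably_equal f f'.
Proof.
move=> Ns ff' sff'.
have [a [b [a_hom b_hom ab]]] := ind_factor two_neq0 ff' sff'.
exists (ind_mod N), a, b; split=> //; apply: contractible_projective.
  exact: ind_spectral.
exact: ind_contractible.
Qed.

Lemma comp_sub_idE (U V : vectType k) (f : 'Hom(U, V)) (h : 'Hom(V, U)) v :
  ((h \o f)%VF - \1%VF) v = h (f v) - v.
Proof. by rewrite add_lfunE opp_lfunE id_lfunE comp_lfunE. Qed.

(** Stable isomorphisms are the homotopy equivalences. *)
Lemma stable_isoP M N : spectral M -> spectral N ->
  stable_iso M N <->
  exists (f : 'Hom(M, N)) (h : 'Hom(N, M)) (s : 'End(M)) (u : 'End(N)),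
    [/\ is_hom f, is_hom h,
        forall v, h (f v) - v = e_op (s v) + s (e_op v)
      & forall v, f (h v) - v = e_op (u v) + u (e_op v)].
Proof.
move=> Ms Ns; split.
  case=> f [h [f_hom h_hom]].
  move=> /stably_equal_homotopy[s sP] /stably_equal_homotopy[u uP].
  exists f, h, s, u; split=> // v.
    by rewrite -comp_sub_idE.
  by rewrite -comp_sub_idE.
case=> f [h [s [u [f_hom h_hom sP uP]]]]; exists f, h.
have [fe fc] := (is_homP two_neq0 _).1 f_hom.
have [he hc] := (is_homP two_neq0 _).1 h_hom.
split=> //; [apply: (@homotopy_stably_equal _ _ s) => // [|v]
            | apply: (@homotopy_stably_equal _ _ u) => // [|v]].
- apply/(is_homP two_neq0); split=> v; rewrite !comp_sub_idE.
    by rewrite fe he linearB.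
  by rewrite fc hc linearB.
- by rewrite comp_sub_idE sP.
- apply/(is_homP two_neq0); split=> v; rewrite !comp_sub_idE.
    by rewrite he fe linearB.
  by rewrite hc fc linearB.
by rewrite comp_sub_idE uP.
Qed.

Lemma stable_iso_sym M N : stable_iso M N -> stable_iso N M.
Proof. by case=> f [h [f_hom h_hom fh hf]]; exists h, f. Qed.

Lemma stable_iso_trans M N P : spectral M -> spectral N -> spectral P ->
  stable_iso M N -> stable_iso N P -> stable_iso M P.
Proof.
move=> Ms Ns Ps /(stable_isoP Ms Ns)[f [h [s [u [f_hom h_hom sP uP]]]]].
case/(stable_isoP Ns Ps) => f' [h' [s' [u' [f'_hom h'_hom s'P u'P]]]].
have [fe fc] := (is_homP two_neq0 _).1 f_hom.
have [he hc] := (is_homP two_neq0 _).1 h_hom.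
have [f'e f'c] := (is_homP two_neq0 _).1 f'_hom.
have [h'e h'c] := (is_homP two_neq0 _).1 h'_hom.
apply/(stable_isoP Ms Ps).
exists (f' \o f)%VF, (h \o h')%VF.
exists ((h \o s' \o f) + s)%VF, ((f' \o u \o h') + u')%VF.
split=> [||v|v].
- by apply/(is_homP two_neq0); split=> v; rewrite !comp_lfunE ?fe ?fc ?f'e ?f'c.
- by apply/(is_homP two_neq0); split=> v; rewrite !comp_lfunE ?h'e ?h'c ?he ?hc.
- rewrite !comp_lfunE (add_lfunE _ s) (add_lfunE _ s) !comp_lfunE linearD /=.
  rewrite addrACA -sP.
  by rewrite -hc fc -linearD -s'P linearB /= addrA addrNK.
rewrite !comp_lfunE (add_lfunE _ u') (add_lfunE _ u') !comp_lfunE linearD /=.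
rewrite addrACA -u'P.
by rewrite -f'c h'c -linearD -uP linearB /= addrA addrNK.
Qed.

End Projective.

(** * Supermodules with one-dimensional homology *)

Section LineType.

Variables (k : closedFieldType) (two_neq0 : 2%:R != 0 :> k).
Implicit Types M N P : supermodule (q1 k).

(** The homology of [M] is the line spanned by the class of [x], of degree [i]:
    the identity is homotopic to the rank one projection v |-> f(v) x. *)
Definition line_type (i : bool) M : Prop :=
  exists (x : M) (f : dual_vs M) (s : 'End(M)),
    [/\ x \in part M i, f \in dual_part M i, e_op x = 0,
        forall v, f (e_op v) = 0 & f x = 1] /\
    forall v, v = (f v : k) *: x + (e_op (s v) + s (e_op v)).

(** The functional f of the first structure does not vanish on the generator y
    of the second one, because y - f(y) x is a boundary on which h vanishes;
    but f vanishes on the degree other than i. *)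
Lemma line_type_unique i j M : line_type i M -> line_type j M -> i = j.
Proof.
case=> x [f [s [[xi fi ex fe fx] sE]]] [y [h [_ [[yj hj ey he hy] _]]]].
have /eqP : h y != 0 by rewrite hy oner_neq0.
rewrite [y in h y]sE ey linear0 addr0 linearD linearZ /= he addr0 => fy0.
apply/eqP; apply: contra_notT fy0 => nij.
have -> : f y = 0; last by rewrite scale0r.
by have /dual_partP -> := fi; move: yj nij; case: i j {xi fi hj} => [] [].
Qed.

Lemma stable_iso_line_type i M N :
  spectral M -> spectral N -> stable_iso M N -> line_type i M -> line_type i N.
Proof.
move=> Ms Ns /(stable_isoP two_neq0 Ms Ns)[f [h [s [u [f_hom h_hom sP uP]]]]].
have [fp _] := f_hom; have [hp _] := h_hom.
have [fe fc] := (is_homP two_neq0 _).1 f_hom.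
have [he hc] := (is_homP two_neq0 _).1 h_hom.
case=> x [p [r [[xi pi ex pe px] rE]]].
exists (f x), (p \o h)%VF, ((f \o r \o h)%VF - u); split; first split.
- exact: fp.
- apply/dual_partP => v vi; rewrite comp_lfunE.
  by have /dual_partP -> := pi; last exact: hp.
- by rewrite -fc ex linear0.
- by move=> v; rewrite comp_lfunE hc pe.
- rewrite comp_lfunE; have /eqP := sP x; rewrite subr_eq => /eqP ->.
  by rewrite ex linear0 addr0 linearD /= pe add0r.
move=> v; rewrite !(add_lfunE _ (- u)) !(opp_lfunE u) !comp_lfunE linearB /=.
rewrite addrACA -opprD -uP opprB -fc hc addrA -linearD -linearZ -linearD -rE.
by rewrite addrC subrK.
Qed.

(** The mutually inverse maps send one homology generator to the other: v |->
    p(v) y and v |-> q(v) x. *)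
Lemma line_type_stable_iso i M N : spectral M -> spectral N ->
  line_type i M -> line_type i N -> stable_iso M N.
Proof.
move=> Ms Ns [x [p [s [[xi pi ex pe px] sE]]]].
case=> y [q [r [[yi qi ey qe qy] rE]]].
have map_hom (M' N' : supermodule (q1 k)) (f : dual_vs M') (z : N') :
    f \in dual_part M' i -> z \in part N' i -> (forall v, f (e_op v) = 0) ->
    e_op z = 0 -> is_hom (lfun_of (scaler_linear_l z) \o f)%VF.
  move=> /dual_partP fi zi fe ez; apply/(is_homP two_neq0); split=> [|v].
    apply/(even_map_part two_neq0) => j v vj; rewrite comp_lfunE lfun_ofE.
    have [<-|nij] := eqVneq i j; first by rewrite memvZ.
    rewrite fi ?scale0r ?mem0v //.
    by move: vj nij; case: (i) (j) => [] [].
  by rewrite !comp_lfunE !lfun_ofE fe scale0r linearZ /= ez scaler0.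
apply/(stable_isoP two_neq0 Ms Ns).
exists (lfun_of (scaler_linear_l y) \o p)%VF.
exists (lfun_of (scaler_linear_l x) \o q)%VF.
exists (- s), (- r); split; [exact: map_hom|exact: map_hom| |] => v.
  rewrite !(opp_lfunE s) !comp_lfunE !lfun_ofE [q _]linearZ /= qy [_ *: 1]mulr1.
rewrite linearN /= -opprD.
  by rewrite {2}[v]sE [in LHS]opprD addNKr.
rewrite !(opp_lfunE r) !comp_lfunE !lfun_ofE [p _]linearZ /= px [_ *: 1]mulr1.
rewrite linearN /= -opprD.
by rewrite {2}[v]rE [in LHS]opprD addNKr.
Qed.

Lemma dual_part_sgr i M (f : dual_vs M) (v : M) :
  f \in dual_part M i -> f (sgr M true v) = (-1) ^+ i * f v.
Proof. exact: (@dual_sgr _ _ M true i f v). Qed.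

Lemma line_type_odd i M : line_type i M ->
  exists (x : M) (f : dual_vs M) (s : 'End(M)),
    [/\ x \in part M i, f \in dual_part M i, e_op x = 0,
        forall v, f (e_op v) = 0 & f x = 1] /\
    odd_map s /\ forall v, v = (f v : k) *: x + (e_op (s v) + s (e_op v)).
Proof.
case=> x [f [s [xf sE]]]; exists x, f, (odd_part s); split=> //; split.
  exact: odd_part_odd.
case: xf => xi fi ex fe fx v.
pose c := (\1 - (lfun_of (scaler_linear_l x) \o f))%VF.
have cE w : c w = w - (f w : k) *: x.
  by rewrite /c add_lfunE opp_lfunE id_lfunE comp_lfunE lfun_ofE.
clearbody c; have sc : homotopy s c.
  by move=> w; rewrite cE {1}[w]sE addrC addKr.
have c_even : even_map c.
  move=> w; rewrite !cE (dual_part_sgr _ fi) linearB /=.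
  rewrite [sgr M true (_ *: _)]linearZ /= (sgr_true_part xi).
  by rewrite scalerA mulrC.
by rewrite -(homotopy_odd sc) (even_part_id two_neq0) // cE addrC subrK.
Qed.

(** The roles of x and f are exchanged, and the homotopy is the transpose of s,
    up to the signs of the dual action. *)
Lemma line_type_dual i M : line_type i M -> line_type i (dual_mod M).
Proof.
case/line_type_odd => x [f [s [[xi fi ex fe fx] [s_odd sE]]]].
have [|ev evE] := @lfun_exists _ (dual_vs M) k^o (fun h : dual_vs M => h x).
  by move=> a h h'; rewrite add_lfunE scale_lfunE.
pose r : 'End(dual_mod M) := - precomp (s \o sgr M true)%VF.
have rE (h : dual_mod M) v :
    (r h : dual_vs M) v = - (h : dual_vs M) (s (sgr M true v)).
  by rewrite !opp_lfunE precompE !comp_lfunE.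
clearbody r; exists f, ev, r; split; first split.
- exact: fi.
- apply/dual_partP => h /dual_partP hi; rewrite evE; apply: hi.
  by rewrite negbK.
- apply/lfunP => v; rewrite e_dual (dual_part_sgr _ fi) fe mulr0 oppr0.
  by rewrite zero_lfunE.
- by move=> h; rewrite evE e_dual ex !linear0.
- by rewrite evE.
move=> h; apply/lfunP => v; rewrite add_lfunE scale_lfunE evE add_lfunE.
rewrite e_dual !rE e_dual sgrK !opprK.
rewrite {1}[v]sE linearD linearZ /= [_ *: h x]mulrC; congr (_ + _).
by rewrite s_odd [e_op (- _)]linearN /= e_op_odd opprK sgrK linearD addrC.
Qed.

End LineType.

(** * Tensor products and endotrivial supermodules *)

Section TensorHomology.

Variables (k : closedFieldType) (two_neq0 : 2%:R != 0 :> k).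
Implicit Types M N P W : supermodule (q1 k).

Lemma tens_functional (U V : vectType k) (f : dual_vs U) (h : dual_vs V) :
  exists F : dual_vs (tens_vs U V), forall u v, F (tens u v) = f u * h v.
Proof.
have [||F [FE _]] := @tens_universal k U V k^o (fun u v => f u * h v).
- by move=> v a u u'; rewrite linearP mulrDl scalerAl.
- by move=> u a v v'; rewrite linearP mulrDr scalerAr.
by exists F.
Qed.

(** For s odd, the cross terms of e (s (x) 1) + (s (x) 1) e cancel, which
    leaves (e s + s e) (x) 1. *)
Lemma contractible_tens M N : contractible M -> contractible (tens_mod M N).
Proof.
case=> s0 /homotopy_odd; set s := odd_part s0 => s_htpy.
have s_odd : odd_map s by apply: odd_part_odd.
have sE v : v = e_op (s v) + s (e_op v).
  rewrite -s_htpy (even_part_id two_neq0) ?id_lfunE // => w.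
  by rewrite !id_lfunE.
clearbody s; pose S : 'End(tens_mod M N) := tmap s \1%VF.
have SE u v : S (tens u v) = tens (s u) v by rewrite tmap_tens id_lfunE.
clearbody S; exists S => X.
rewrite -!(comp_lfunE _ _ X) -add_lfunE; move: X; apply/lfunP/tens_ext => u v.
rewrite id_lfunE add_lfunE !comp_lfunE SE !e_tens linearD /= !SE s_odd.
rewrite -[- sgr _ _ _]scaleN1r tensZl scaleN1r addrACA subrr addr0 -tensDl.
by rewrite -sE.
Qed.

(** Let a be the projection v |-> f(v) x. The homotopy s (x) 1 deforms the
    identity into a (x) 1, and a (x) r, with the Koszul sign, deforms the
    latter into the projection onto the line of x (x) y. *)
Lemma line_type_tens i j M N :
  line_type i M -> line_type j N -> line_type (i (+) j) (tens_mod M N).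
Proof.
case/(line_type_odd two_neq0) => x [f [s [[xi fi ex fe fx] [s_odd sE]]]].
case=> y [h [r [[yj hj ey he hy] rE]]].
have [F FE] := tens_functional f h.
pose a : 'End(M) := (lfun_of (scaler_linear_l x) \o f)%VF.
have aE u : a u = f u *: x by rewrite comp_lfunE lfun_ofE.
have sgr_a u : sgr M true (a (sgr M true u)) = a u.
  rewrite !aE (dual_part_sgr _ fi) linearZ /= (sgr_true_part xi) scalerA.
  by rewrite mulrAC -signr_addb addbb mul1r.
pose S : 'End(tens_mod M N) := tmap s \1%VF + tmap (sgr M true \o a)%VF r.
have SE u v : S (tens u v) = tens (s u) v + tens (sgr M true (a u)) (r v).
  by rewrite add_lfunE !tmap_tens id_lfunE comp_lfunE.
clearbody S a; exists (tens x y), F, S; split; first split.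
- exact: mem_tens.
- apply/dual_partP => w wij; apply/eqP; rewrite -memv0.
  apply: tens_part_ind wij => l u v ul vl; rewrite memv0 FE.
  have [lE|nli] := eqVneq l i.
    have /dual_partP -> := hj; first by rewrite mulr0.
    by rewrite lE addbN addKb in vl.
  have /dual_partP -> := fi; first by rewrite mul0r.
  by move: ul nli; case: (l) (i) => [] [].
- by rewrite e_tens ex ey tens0l tens0r addr0.
- move=> X; rewrite -comp_lfunE -[RHS](@zero_lfunE _ _ k^o X).
  move: X; apply/lfunP/tens_ext => u v; rewrite comp_lfunE zero_lfunE e_tens.
  by rewrite linearD /= !FE fe he mul0r mulr0 addr0.
- by rewrite FE fx hy mulr1.
pose c := lfun_of (scaler_linear_l (tens x y : tens_mod M N)).
have cE b : c b = b *: tens x y by rewrite lfun_ofE.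
clearbody c => X; rewrite -cE -!(comp_lfunE _ _ X) -!add_lfunE -[LHS]id_lfunE.
move: X; apply/lfunP/tens_ext => u v.
rewrite id_lfunE !add_lfunE !comp_lfunE cE FE.
have eau : e_op (sgr M true (a u)) = 0.
  by rewrite e_op_odd aE linearZ /= ex scaler0 linear0 oppr0.
have aeu : a (e_op u) = 0 by rewrite aE fe scale0r.
have -> : e_op (S (tens u v : tens_mod M N)) = tens (e_op (s u)) v
    + (tens (sgr M true (s u)) (e_op v) + tens (a u) (e_op (r v))).
  rewrite SE linearD /= !e_tens eau tens0l add0r sgrK.
  by rewrite addrA.
have -> : S (e_op (tens u v : tens_mod M N)) = tens (s (e_op u)) v
    + (- tens (sgr M true (s u)) (e_op v) + tens (a u) (r (e_op v))).
  rewrite e_tens linearD /= !SE aeu linear0 tens0l addr0 sgr_a s_odd.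
  by rewrite -scaleN1r tensZl scaleN1r.
rewrite addrACA -tensDl [X in _ = _ + (_ + X)]addrACA subrr add0r -tensDr aE.
have -> : (f u * h v) *: tens x y = tens (f u *: x) (h v *: y).
  by rewrite tensZl tensZr scalerA.
by rewrite addrCA -tensDr -rE addrC -tensDl -sE.
Qed.

Lemma part_sum M N i (w : sum_mod M N) :
  (w \in part (sum_mod M N) i) = (w.1 \in part M i) && (w.2 \in part N i).
Proof. exact: sum_partE. Qed.

Lemma e_sum M N (w : sum_mod M N) : e_op w = (e_op w.1, e_op w.2).
Proof. by rewrite !e_opE; apply: prod_mapE. Qed.

Lemma e_triv (v : triv_mod (q1 k)) : e_op v = 0.
Proof. by rewrite e_opE; apply: zero_lfunE. Qed.

(** Transport through the isomorphism the projection onto the summand k_ev and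
    a contraction of the other summand. *)
Lemma iso_line_type W P :
  projectiveF P -> iso W (sum_mod (triv_mod (q1 k)) P) -> line_type false W.
Proof.
move=> /(projective_contractible two_neq0)[s sP] [f [h [f_hom h_hom fK hK]]].
have [fp _] := f_hom; have [hp _] := h_hom.
have [_ fc] := (is_homP two_neq0 _).1 f_hom.
have [_ hc] := (is_homP two_neq0 _).1 h_hom.
pose T := sum_mod (triv_mod (q1 k)) P.
have [|w wE] := @lfun_exists _ W k^o (fun v => (f v).1).
  by move=> a u v; rewrite linearP.
have [|i iE] := @lfun_exists _ P T (fun u => (0, u)).
  by move=> a u v; congr (_, _); rewrite [RHS]addr0 [RHS]scaler0.
have [|q qE] := @lfun_exists _ T P snd; first by [].
pose x : T := (1, 0).
exists (h x), w, (h \o i \o s \o q \o f)%VF; split; first split.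
- by apply: hp; rewrite part_sum /= memvf mem0v.
- apply/dual_partP => v /(fp _); rewrite wE part_sum => /andP[].
  by rewrite memv0 => /eqP.
- by rewrite -hc e_sum e_triv linear0 linear0.
- by move=> v; rewrite wE fc e_sum e_triv.
- by rewrite wE hK.
move=> v; rewrite !comp_lfunE !qE fc e_sum /= -hc wE -linearZ -!linearD /=.
rewrite -[LHS]fK; congr (h _).
rewrite !iE (@e_sum (triv_mod (q1 k)) P) e_triv /=.
case: (f v) => c u /=; congr (_, _); rewrite /= ?addr0 ?[_ *: 1]mulr1 //.
by rewrite scaler0 add0r -sP id_lfunE.
Qed.

End TensorHomology.

Section Submodule.

Variables (k : fieldType) (W : supermodule (q1 k)) (K : {vspace W}).
Hypothesis K_graded : forall i w, w \in K -> proj W i w \in K.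
Hypothesis K_stable : forall w, w \in K -> e_op w \in K.

Definition sub_incl : 'Hom(subvs_of K, W) := linfun (vsval : subvs_of K -> W).

Lemma sub_inclE u : sub_incl u = vsval u.
Proof. exact: lfunE. Qed.

Definition sub_part (i : bool) : {vspace subvs_of K} :=
  (sub_incl @^-1: part W i)%VS.

Lemma sub_partE i u : (u \in sub_part i) = (vsval u \in part W i).
Proof. by rewrite -memv_preim sub_inclE. Qed.

Definition sub_restr (f : 'End(W)) : 'End(subvs_of K) :=
  (linfun (vsproj K) \o f \o sub_incl)%VF.

Lemma sub_restrE (f : 'End(W)) u :
  (forall w, w \in K -> f w \in K) -> vsval (sub_restr f u) = f (vsval u).
Proof.
by move=> fK; rewrite !comp_lfunE sub_inclE lfunE /= vsprojK // fK ?subvsP.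
Qed.

Fact sub_split :
  (sub_part false :&: sub_part true = 0)%VS /\
  (sub_part false + sub_part true = fullv)%VS.
Proof.
have vE i u : vsval (sub_restr (proj W i) u) = proj W i (vsval u).
  by rewrite sub_restrE // => w; apply: K_graded.
apply: (split_direct (p := fun i => sub_restr (proj W i))) => [i u|i u|u].
- by rewrite sub_partE vE mem_proj.
- by rewrite sub_partE => ui; apply: subvs_inj; rewrite vE proj_id.
by apply: subvs_inj; rewrite linearD /= !vE proj_sum.
Qed.

Definition sub_space : superspace k :=
  Superspace (proj1 sub_split) (proj2 sub_split).

Fact sub_op_odd i (v : sub_space) :
  v \in part sub_space i -> sub_restr e_op v \in part sub_space (~~ i).
Proof.
rewrite ![_ \in part sub_space _]sub_partE sub_restrE // => vi.
by have := act_graded (q1_e_part k) vi; rewrite -e_opE.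
Qed.

Definition sub_mod : supermodule (q1 k) := q1_mod sub_op_odd.

Lemma e_sub (u : sub_mod) :
  vsval (e_op u : subvs_of K) = e_op (vsval (u : subvs_of K)).
Proof. by rewrite q1_mod_e sub_restrE. Qed.

End Submodule.

Section Endotrivial.

Variables (k : closedFieldType) (two_neq0 : 2%:R != 0 :> k).
Implicit Types M N P W : supermodule (q1 k).

(** The complement is the kernel of the functional w, which is a retract of [W]
    under v |-> v - w(v) x and is contracted by the restriction of s. *)
Lemma line_type_iso W : spectral W -> line_type false W ->
  exists P, projectiveF P /\ iso W (sum_mod (triv_mod (q1 k)) P).
Proof.
move=> Ws [x [w [s [[x0 w0 ex we wx] sE]]]].
have /dual_partP wodd := w0.
have Kg i v : v \in lker w -> proj W i v \in lker w.
  rewrite !memv_ker => /eqP wv; case: i; first by rewrite wodd ?mem_proj.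
  have := wv; rewrite -[v in w v]proj_sum linearD /= (wodd (proj W true v)).
    by rewrite addr0 => ->.
  exact: mem_proj.
have Ke v : v \in lker w -> e_op v \in lker w by rewrite !memv_ker we.
pose P := sub_mod Kg Ke.
pose i : 'Hom(P, W) := sub_incl (lker w).
have iE u : i u = vsval (u : subvs_of (lker w)) by apply: sub_inclE.
have ie u : i (e_op u) = e_op (i u) by rewrite !iE e_sub.
pose c : 'End(W) := (\1 - (lfun_of (scaler_linear_l x) \o w))%VF.
have cE v : c v = v - (w v : k) *: x.
  by rewrite /c add_lfunE opp_lfunE id_lfunE comp_lfunE lfun_ofE.
clearbody c; pose r : 'Hom(W, P) := (linfun (vsproj (lker w)) \o c)%VF.
have ir v : i (r v) = v - (w v : k) *: x.
  rewrite iE comp_lfunE lfunE /= vsprojK cE // memv_ker linearB linearZ /= wx.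
  by rewrite [_ *: 1]mulr1 subrr.
have i_inj : injective i by move=> u v; rewrite !iE => /subvs_inj.
have wi u : w (i u) = 0 by apply/eqP; rewrite -memv_ker iE subvsP.
have i_part j u : (i u \in part W j) = (u \in part P j).
  by rewrite iE -(sub_partE (K := lker w)).
have ri : cancel i r by move=> u; apply: i_inj; rewrite ir wi scale0r subr0.
have re v : r (e_op v) = e_op (r v).
  apply: i_inj; rewrite ie !ir we scale0r subr0 linearB linearZ /= ex.
  by rewrite scaler0 subr0.
clearbody i r.
have Ps : spectral P.
  apply: (spectral_retract (i := i) (r := r)) => // v.
    by rewrite !(t_op_sq two_neq0) !ie.
  by rewrite !(t_op_sq two_neq0) !re.
have Pc : contractible P.
  exists (r \o s \o i)%VF => u; rewrite id_lfunE !comp_lfunE ie -re -linearD.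
  by have := sE (i u); rewrite wi scale0r add0r => <-; rewrite /= ri.
exists P; split; first exact: contractible_projective.
pose T := sum_mod (triv_mod (q1 k)) P.
have [|f fE] := @lfun_exists _ W T (fun v => (w v, r v)).
  by move=> a u v; rewrite !linearP.
have [|h hE] := @lfun_exists _ T W (fun u => (u.1 : k) *: x + i u.2).
  move=> a u v; rewrite /= linearP scalerDr scalerDl -!addrA; congr (_ + _).
    by rewrite scalerA.
  by rewrite addrCA.
have fK : cancel f h by move=> v; rewrite hE fE /= ir addrC subrK.
have hK : cancel h f.
  move=> -[a u]; rewrite fE hE /= !linearD !linearZ /= wx wi ri addr0.
  have -> : r x = 0 by apply: i_inj; rewrite ir wx scale1r subrr linear0.
  by rewrite scaler0 add0r [_ *: 1]mulr1.
have h_hom : is_hom h.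
  apply/(is_homP two_neq0); split=> [|u]; last first.
    rewrite !hE e_sum e_triv scale0r add0r /= ie linearD linearZ /= ex.
    by rewrite scaler0 add0r.
  apply/(even_map_part two_neq0) => j u; rewrite hE part_sum => /andP[u1 u2].
  rewrite memvD ?i_part //; case: j u1 {u2} => /= [|_]; last by rewrite memvZ.
  by rewrite memv0 => /eqP ->; rewrite scale0r mem0v.
have f_hom : is_hom f.
  apply/(is_homP two_neq0); split=> [|v]; last first.
    by rewrite !fE e_sum e_triv we re.
  apply/(even_map_part two_neq0) => j v vj.
  rewrite fE part_sum -i_part ir /=; case: j vj => vj.
    by rewrite wodd // mem0v scale0r subr0.
  by rewrite memvf memvB ?memvZ.
by exists f, h.
Qed.


(** A nonzero homology class, together with an invariant functional that
    detects it; both can be taken homogeneous since q is even. *)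
Lemma homology_class M (q : 'End(M)) :
    even_map q -> (forall v, e_op (q v) = 0) -> (forall v, q (e_op v) = 0) ->
    (forall v, q (q v) = q v) -> q != 0 ->
  exists i (x : M) (f : dual_vs M),
    [/\ x \in part M i, f \in dual_part M i, e_op x = 0,
        forall v, f (e_op v) = 0 & f x = 1] /\
    q x = x /\ forall v, f (q v) = f v.
Proof.
move=> q_even eq qe qq /lfunPn[z]; rewrite zero_lfunE => qz.
have q_part := (even_map_part two_neq0 q).1 q_even.
have [i qi] : exists i, q (proj M i z) != 0.
  have [q0|q1] := eqVneq (q (proj M false z)) 0; last by exists false.
  exists true; apply: contra_neq qz => q1.
  by rewrite -(proj_sum z) linearD /= q0 q1 addr0.
have [f0 f0x] := functional_exists qi.
pose f : dual_vs M := (f0 \o proj M i \o q)%VF.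
have fE v : f v = f0 (proj M i (q v)) by rewrite !comp_lfunE.
have xi : q (proj M i z) \in part M i by apply/q_part/mem_proj.
exists i, (q (proj M i z)), f; split; first split=> //.
- apply/dual_partP => v vi; rewrite fE (proj_part _ (q_part _ _ vi)).
  by case: (i); rewrite /= linear0.
- by move=> v; rewrite fE qe !linear0.
- by rewrite fE qq proj_id.
by split=> // v; rewrite !fE qq.
Qed.

(** Homogeneity ensures that f changes only by a sign when composed with the
    parity involution that occurs in the dual action. *)
Lemma dual_cycle i M (f : dual_vs M) :
    f \in dual_part M i -> (forall v, f (e_op v) = 0) ->
  e_op (f : dual_mod M) = 0.
Proof.
move=> fi fe; apply/lfunP => v.
by rewrite e_dual (dual_part_sgr _ fi) fe mulr0 oppr0 zero_lfunE.
Qed.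

(** The functional u (x) h |-> f(u) h(x) is invariant because f vanishes on the
    image of e and x is killed by e. *)
Lemma eval_functional M (f : dual_vs M) (x : M) :
    e_op x = 0 -> (forall v, f (e_op v) = 0) ->
  exists F : dual_vs (tens_mod M (dual_mod M)),
    (forall u (h : dual_vs M), F (tens u h) = f u * h x) /\
    forall X : tens_mod M (dual_mod M), F (e_op X) = 0.
Proof.
move=> ex fe.
have [|ev evE] := @lfun_exists _ (dual_vs M) k^o (fun h : dual_vs M => h x).
  by move=> a h h'; rewrite add_lfunE scale_lfunE.
have [F FE] := tens_functional f ev.
exists F; split=> [u h|X]; first by rewrite FE evE.
rewrite -comp_lfunE -[RHS](@zero_lfunE _ _ k^o X).
move: X; apply/lfunP/tens_ext => u h; rewrite comp_lfunE zero_lfunE e_tens.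
by rewrite linearD /= !FE fe !evE e_dual ex !linear0 mul0r mulr0 addr0.
Qed.

(** The pairing of invariant functionals with cycles of M (x) M^* has rank at
    most one. If p were of rank at least two, two independent classes x, y of M
    with dual functionals f, h would give the cycles x (x) f and y (x) h, and
    the functionals F, H that are dual to them. *)
Lemma endomorphism_line_type M : spectral M ->
  line_type false (tens_mod M (dual_mod M)) -> exists i, line_type i M.
Proof.
move=> Ms [w0 [w [r [[_ _ ew we ww] rE]]]].
have pairing (a : tens_mod M (dual_mod M))
    (F : dual_vs (tens_mod M (dual_mod M))) :
    e_op a = 0 -> (forall X, F (e_op X) = 0) -> F a = w a * F w0.
  move=> ea Fe.
  by rewrite {1}[a]rE ea linear0 addr0 linearD linearZ /= Fe addr0.
have [s [p [[_ p_even sp] [ep pe pp]]]] := splitting two_neq0 Ms.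
have {}sp v : v - p v = e_op (s v) + s (e_op v).
  by rewrite -sp add_lfunE opp_lfunE id_lfunE.
have [p0|p_neq0] := eqVneq p 0.
  have Mc : contractible M.
    by exists s => v; rewrite id_lfunE -sp p0 zero_lfunE subr0.
  have [h hE] := contractible_tens two_neq0 (dual_mod M) Mc.
  have := ww; have := hE w0; rewrite id_lfunE ew linear0 addr0 => ->.
  by rewrite we => /esym/eqP; rewrite oner_eq0.
have [i [x [f [[xi fi ex fe fx] [px fp]]]]] :=
  homology_class p_even ep pe pp p_neq0.
(* What is left of p after splitting off the line of x: an idempotent with
   d x = 0 and f d = 0. *)
pose d : 'End(M) := p - (lfun_of (scaler_linear_l x) \o f)%VF.
have dE v : d v = p v - (f v : k) *: x.
  by rewrite /d add_lfunE opp_lfunE comp_lfunE lfun_ofE.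
have [d0|d_neq0] := eqVneq d 0.
  exists i, x, f, s; split=> // v; rewrite -sp.
  have /eqP : d v = 0 by rewrite d0 zero_lfunE.
  by rewrite dE subr_eq0 => /eqP ->; rewrite addrC subrK.
clearbody d; have d_even : even_map d.
  move=> v; rewrite !dE p_even (dual_part_sgr _ fi) linearB /=.
  by rewrite [sgr M true (_ *: _)]linearZ /= (sgr_true_part xi) scalerA mulrC.
have fd v : f (d v) = 0.
  by rewrite dE linearB linearZ /= fx fp [_ *: 1]mulr1 subrr.
have dx : d x = 0 by rewrite dE px fx scale1r subrr.
have [||v|j [y [h [[yj hj ey he hy] [dy hd]]]]] :=
  homology_class d_even _ _ _ d_neq0.
- by move=> v; rewrite dE linearB linearZ /= ep ex scaler0 subr0.
- by move=> v; rewrite dE pe fe scale0r subr0.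
- by rewrite dE fd scale0r subr0 dE linearB linearZ /= pp px.
have fy : f y = 0 by rewrite -dy fd.
have hx : h x = 0 by rewrite -hd dx linear0.
have [F [FE Fe]] := eval_functional ex fe.
have [H [HE He]] := eval_functional ey he.
pose a : tens_mod M (dual_mod M) := tens x (f : dual_mod M).
pose b : tens_mod M (dual_mod M) := tens y (h : dual_mod M).
have ea : e_op a = 0.
  by rewrite e_tens ex (dual_cycle fi fe) tens0l tens0r addr0.
have eb : e_op b = 0.
  by rewrite e_tens ey (dual_cycle hj he) tens0l tens0r addr0.
have Fa := pairing a F ea Fe; have Fb := pairing b F eb Fe.
have Hb := pairing b H eb He.
move: Fb; rewrite FE fy mul0r => /esym/eqP; rewrite mulf_eq0 => /orP[] /eqP E0.
  by move: Hb; rewrite HE hy E0 mul0r mulr1 => /eqP; rewrite oner_eq0.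
by move: Fa; rewrite FE fx E0 mulr0 mulr1 => /eqP; rewrite oner_eq0.
Qed.

(** If M is of type i, then M (x) M^* is of type i + i = 0. *)
Lemma endotrivial_line_type M :
  endotrivial M <-> spectral M /\ exists i, line_type i M.
Proof.
split=> [[/inF_spectral Ms [P [Pproj MP]]]|[Ms [i iM]]].
  split=> //; apply: endomorphism_line_type => //.
  exact: iso_line_type MP.
split; first exact: spectral_inF.
apply: line_type_iso; first exact/spectral_tens/spectral_dual.
rewrite -(addbb i); apply: line_type_tens => //; exact: line_type_dual.
Qed.

End Endotrivial.

Section LineModule.

Variable k : closedFieldType.

Section GradedLine.
Variable i : bool.

Definition graded_line_part (j : bool) : {vspace k^o} :=
  if i == j then fullv else 0%VS.

Fact graded_line_direct :
  (graded_line_part false :&: graded_line_part true = 0)%VS.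
Proof. by rewrite /graded_line_part; case: i; rewrite ?cap0v ?capv0. Qed.

Fact graded_line_full :
  (graded_line_part false + graded_line_part true = fullv)%VS.
Proof. by rewrite /graded_line_part; case: i; rewrite ?add0v ?addv0. Qed.

Definition graded_line : superspace k :=
  Superspace graded_line_direct graded_line_full.
End GradedLine.

Fact zero_odd (V : superspace k) i v :
  v \in part V i -> (0 : 'End(V)) v \in part V (~~ i).
Proof. by rewrite zero_lfunE mem0v. Qed.

Definition line_mod (i : bool) : supermodule (q1 k) :=
  q1_mod (@zero_odd (graded_line i)).

Lemma line_mod_e i (v : line_mod i) : e_op v = 0.
Proof. by rewrite q1_mod_e zero_lfunE. Qed.

Lemma line_mod_type i : line_type i (line_mod i).
Proof.
exists (1 : k^o), (\1%VF : 'End(k^o)), 0; split; first split.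
- by rewrite /= /graded_line_part eqxx memvf.
- apply/dual_partP => v; rewrite /= /graded_line_part; case: (i) => /=;
    by rewrite memv0 => /eqP ->; apply: linear0.
- exact: line_mod_e.
- by move=> v; rewrite line_mod_e linear0.
- exact: id_lfunE.
move=> v; rewrite id_lfunE zero_lfunE linear0 line_mod_e linear0 !addr0.
by rewrite [_ *: _]mulr1.
Qed.

Lemma line_mod_spectral i : spectral (line_mod i).
Proof.
have t0 (v : line_mod i) : t_op v = 0.
  by rewrite t_opE [LHS]q1_actE /= !zero_lfunE !scaler0 addr0.
exists unit, (fun=> 0), (fun=> \1%VF); split=> [v|_ v|_ v].
- by rewrite (big_pred1 tt) ?id_lfunE //; case.
- by rewrite t0 scale0r.
by rewrite t0 linear0 scale0r.
Qed.

End LineModule.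

(** * The group T(q(1)) *)

Section StableClasses.

Variables (k : closedFieldType) (two_neq0 : 2%:R != 0 :> k).
Implicit Types M N : supermodule (q1 k).

(** Stable isomorphism is an equivalence relation on F, so the two classes have
    the same members; extensionality makes them equal. *)
Lemma cls_eq M N (Me : endotrivial M) (Ne : endotrivial N) :
  stable_iso M N -> cls Me = cls Ne.
Proof.
move=> MN.
have [Ms _] := (endotrivial_line_type two_neq0 M).1 Me.
have [Ns _] := (endotrivial_line_type two_neq0 N).1 Ne.
have classE : stable_class M = stable_class N.
  apply/funext => L; apply/propext; split=> -[Lf ML]; split=> //.
    apply: (stable_iso_trans two_neq0 Ns Ms (inF_spectral Lf)) ML.
    exact: stable_iso_sym.
  exact: (stable_iso_trans two_neq0 Ms Ns (inF_spectral Lf)) MN ML.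
rewrite /cls; move: (ex_intro2 _ _ M _ _); rewrite classE => H.
by congr exist; apply: Prop_irrelevance.
Qed.

Lemma line_mod_endotrivial i : endotrivial (line_mod k i).
Proof.
apply/(endotrivial_line_type two_neq0); split; first exact: line_mod_spectral.
by exists i; apply: line_mod_type.
Qed.

Definition has_odd_member (c : TG (q1 k)) : Prop :=
  exists M, sval c M /\ line_type true M.

Definition parity (c : TG (q1 k)) : bool := `[< has_odd_member c >].

Lemma parity_cls M (Me : endotrivial M) i :
  line_type i M -> parity (cls Me) = i.
Proof.
move=> Mi; have [Ms _] := (endotrivial_line_type two_neq0 M).1 Me.
apply/asboolP/idP => [[N [[Nf MN] Nt]]|it].
  have Ns := inF_spectral Nf.
  by rewrite (line_type_unique (stable_iso_line_type two_neq0 Ms Ns MN Mi) Nt).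
exists M; rewrite -it; split=> //; split; first exact: spectral_inF.
exact: (line_type_stable_iso two_neq0 Ms Ms Mi Mi).
Qed.

Lemma cls_parity M (Me : endotrivial M) :
  cls Me = cls (line_mod_endotrivial (parity (cls Me))).
Proof.
have [Ms [i Mi]] := (endotrivial_line_type two_neq0 M).1 Me.
apply: cls_eq; rewrite (parity_cls Me Mi).
by apply: (line_type_stable_iso two_neq0 Ms _ Mi (line_mod_type k i));
  apply: line_mod_spectral.
Qed.

End StableClasses.

Theorem proposition4p1 (k : closedFieldType) (k_char0 : [pchar k] =i pred0) :
  exists add : TG (q1 k) -> TG (q1 k) -> TG (q1 k),
    tensor_law add /\
    exists phi : TG (q1 k) -> 'Z_2,
      bijective phi /\ forall c d, phi (add c d) = phi c + phi d.
Proof.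
have two_neq0 : 2%:R != 0 :> k by have := k_char0 2; rewrite !inE /= => ->.
pose line i := cls (line_mod_endotrivial two_neq0 i).
have line_parity c : line (parity c) = c.
  case: c => C [M Me CE]; subst C; exact/esym/(cls_parity two_neq0 Me).
have parity_line i : parity (line i) = i.
  exact/(parity_cls two_neq0)/line_mod_type.
pose add (c d : TG (q1 k)) := line (parity c (+) parity d).
exists add; split=> [M N Me Ne|].
  have [Ms [i Mi]] := (endotrivial_line_type two_neq0 M).1 Me.
  have [Ns [j Nj]] := (endotrivial_line_type two_neq0 N).1 Ne.
  have MNij := line_type_tens two_neq0 Mi Nj.
  have MNe : endotrivial (tens_mod M N).
    apply/(endotrivial_line_type two_neq0); split; first exact: spectral_tens.
    by exists (i (+) j).
  exists MNe; rewrite -[RHS]line_parity (parity_cls two_neq0 MNe MNij) /add.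
  by rewrite (parity_cls two_neq0 Me Mi) (parity_cls two_neq0 Ne Nj).
exists (fun c => (parity c)%:R); split=> [|c d].
  exists (fun z : 'Z_2 => line (z == 1)) => [c|z].
    by rewrite -[RHS]line_parity; case: (parity c).
  by rewrite parity_line; apply/val_inj; case: z => [] [|[|]].
by rewrite parity_line; case: (parity c) (parity d) => [] []; apply/val_inj.
Qed.
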